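(* Suppose that $A$ is a set of regular cardinals and $I$ is an ideal on $A$ with $\mathrm{reg}(I)<\min(A)$. Let $\lambda>\mathrm{reg}(I)$ be a regular cardinal such that $\prod A/I$ is $\lambda$-directed, and let $\vec{f}=\langle f_\xi : \xi<\lambda\rangle$ be any $<_I$-increasing sequence of functions in $\prod A$. Then there exists a sequence $\vec{g}=\langle g_\xi : \xi<\lambda\rangle$ of functions in $\prod A$ such that: (1) $\vec{g}$ is $<_I$-increasing; (2) for each $\xi<\lambda$, $f_\xi<g_{\xi+1}$ (everywhere on $A$); (3) for every regular $\theta<\lambda$ such that $\theta^{++}<\lambda$, $\{a\in A : a\leq \theta^{++}\}\in I$, and $I$ is $\theta$-regular, the sequence $\vec{g}$ satisfies $\mathrm{Good}_\theta$.
   Context: $\mathrm{ON}$ is the class of ordinals, and $\prod A$ is the set of functions $f$ on $A$ with $f(a)\in a$ for all $a\in A$. For functions $f,g:A\to\mathrm{ON}$ and a relation $R$ on the ordinals, $f\,R_I\,g$ means $\{a\in A:\neg(f(a)\,R\,g(a))\}\in I$. A sequence $\langle f_\xi:\xi<\lambda\rangle$ is $<_I$-increasing if $f_\eta<_I f_\xi$ whenever $\eta<\xi<\lambda$. $\prod A/I$ is $\lambda$-directed if every $F\subseteq\prod A$ with $|F|<\lambda$ has a $\le_I$-upper bound in $\prod A$. A set $B\subseteq A$ is $I$-positive if $B\notin I$. For a regular cardinal $\theta$, $I$ is weakly $\theta$-saturated if there is no partition of $A$ into $\theta$-many $I$-positive sets; $I$ is $\theta$-indecomposable if $I$ is closed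 under $\subseteq$-increasing unions of length $\theta$; $I$ is $\theta$-regular if it is both weakly $\theta$-saturated and $\theta$-indecomposable (equivalently: whenever $\langle A_i:i<\theta\rangle$ is a sequence of $I$-positive sets there is $H\in[\theta]^\theta$ with $\bigcap_{i\in H}A_i\neq\emptyset$). $\mathrm{reg}(I)$ denotes the least regular cardinal $\theta$ such that $I$ is $\theta$-regular. Let $F$ be a collection of functions from $A$ to $\mathrm{ON}$. A function $f:A\to\mathrm{ON}$ is an upper bound for $F$ if $g\le_I f$ for all $g\in F$; it is a least upper bound if additionally $f\le_I f'$ for every upper bound $f'$ of $F$; it is an exact upper bound if it is a least upper bound and $F$ is $<_I$-cofinal in $\{g\in{}^A\mathrm{ON}: g<_I f\}$. A $<_I$-increasing sequence satisfies $\mathrm{Good}_\theta$ if it has an exact upper bound $f\in{}^A\mathrm{ON}$ with $\{a\in A:\mathrm{cf}(f(a))<\theta\}\in I$. *)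

(* Defs.v *)
From HB Require Import structures.
From mathcomp Require Import all_boot.
From mathcomp Require Import generic_quotient.
From mathcomp Require Import boolp classical_sets functions cardinality.
From mathcomp Require wochoice.

Set Implicit Arguments.
Unset Strict Implicit.
Unset Printing Implicit Defensive.

Local Open Scope classical_set_scope.
Local Open Scope card_scope.

(* Ordinals are the isomorphism classes of well-orders on types of a fixed
   universe; [ON] itself lives one universe higher, so it is a proper class
   with respect to the well-orders it classifies. *)
Record wellOrder : Type := WellOrder {
  wo_sort :> Type ;
  wo_le : rel wo_sort ;
  wo_leP : wochoice.well_order wo_le }.

Definition wo_iso (W V : wellOrder) : Prop :=
  exists2 f : W -> V, bijective f & {mono f : x y / wo_le x y}.

Definition wo_isob : rel {classic wellOrder} := fun W V => `[< wo_iso W V >].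

Lemma wo_isob_refl : reflexive wo_isob.
Proof. by move=> W; apply/asboolP; exists id => //; exists id. Qed.

Lemma wo_isob_sym : symmetric wo_isob.
Proof.
suff sub W V : wo_iso W V -> wo_iso V W.
  by move=> W V; apply/asboolP/asboolP; apply: sub.
case=> f [g fK gK] fm; exists g; first by exists f.
by move=> x y; rewrite -[RHS](congr2 (@wo_le V) (gK x) (gK y)) fm.
Qed.

Lemma wo_isob_trans : transitive wo_isob.
Proof.
move=> V W U /asboolP[f bf fm] /asboolP[g bg gm]; apply/asboolP.
by exists (g \o f); [exact: bij_comp | move=> x y /=; rewrite gm fm].
Qed.

Canonical wo_iso_equiv :=
  EquivRel wo_isob wo_isob_refl wo_isob_sym wo_isob_trans.

Definition ON : Type := {eq_quot wo_isob}%qT.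
HB.instance Definition _ := EqQuotient.on ON.
HB.instance Definition _ := Choice.on ON.

Definition wo_rep (alpha : ON) : wellOrder := repr alpha.

(* [alpha < beta]: [alpha] is isomorphic to a proper initial segment of
   [beta]. *)
Definition ord_lt (alpha beta : ON) : Prop :=
  exists (f : wo_rep alpha -> wo_rep beta) (b : wo_rep beta),
    {mono f : x y / wo_le x y} /\ range f = [set y | ~~ wo_le b y].

Definition ord_le (alpha beta : ON) : Prop := alpha = beta \/ ord_lt alpha beta.

Notation "x <o y" := (ord_lt x y) (at level 70, no associativity).
Notation "x <=o y" := (ord_le x y) (at level 70, no associativity).

(* The von Neumann ordinal [alpha], as a subclass of [ON]. *)
Definition below (alpha : ON) : set ON := [set beta | beta <o alpha].

Lemma void_well_order : wochoice.well_order (fun _ _ : void => true).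
Proof. by move=> X [[]]. Qed.

Definition ord0 : ON :=
  (\pi_ON%qT (WellOrder void_well_order : {classic wellOrder})).

(* The least element of [P]; [ord0] when [P] is empty. *)
Definition ord_min (P : set ON) : ON :=
  xget ord0 [set alpha | P alpha /\ forall beta, P beta -> alpha <=o beta].

Definition ord_succ (alpha : ON) : ON := ord_min [set beta | alpha <o beta].

(* A class of ordinals is a set exactly when it is bounded. *)
Definition is_small (A : set ON) : Prop := exists beta, A `<=` below beta.

Definition cofinality (alpha : ON) : ON :=
  ord_min [set beta | exists h : ON -> ON,
    (forall delta, delta <o beta -> h delta <o alpha) /\
    (forall gamma, gamma <o alpha ->
       exists2 delta, delta <o beta & gamma <=o h delta)].

Definition is_cardinal (kappa : ON) : Prop :=
  forall alpha, alpha <o kappa -> ~ (below kappa #<= below alpha).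

Definition is_regular_cardinal (kappa : ON) : Prop :=
  [/\ is_cardinal kappa, infinite_set (below kappa) & cofinality kappa = kappa].

Definition card_succ (kappa : ON) : ON :=
  ord_min [set mu | is_cardinal mu /\ kappa <o mu].

Definition card_smaller T (X : set T) (kappa : ON) : Prop :=
  X #<= below kappa /\ ~ (below kappa #<= X).

Section Ideals.
Variable T : Type.
Implicit Types (I : set (set T)) (theta : ON).

(* Ideals are not required to be proper. *)
Definition is_ideal I : Prop :=
  [/\ I set0,
      (forall X Y : set T, X `<=` Y -> I Y -> I X) &
      (forall X Y : set T, I X -> I Y -> I (X `|` Y))].

Definition positive I (X : set T) : Prop := ~ I X.

Definition weakly_saturated I theta : Prop :=
  ~ exists2 B : ON -> set T,
      partition (below theta) B [set: T] &
      forall i, i <o theta -> positive I (B i).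

Definition indecomposable I theta : Prop :=
  forall B : ON -> set T,
    (forall i, i <o theta -> I (B i)) ->
    (forall i j, i <o j -> j <o theta -> B i `<=` B j) ->
    I (\bigcup_(i in below theta) B i).

Definition regular_ideal I theta : Prop :=
  weakly_saturated I theta /\ indecomposable I theta.

Definition reg I : ON :=
  ord_min [set theta | is_regular_cardinal theta /\ regular_ideal I theta].

Definition rel_mod I (R : ON -> ON -> Prop) (f g : T -> ON) : Prop :=
  I [set a | ~ R (f a) (g a)].

Definition lt_mod I := rel_mod I ord_lt.
Definition le_mod I := rel_mod I ord_le.

Implicit Types (F : set (T -> ON)) (f : T -> ON).

Definition is_upper_bound I F f : Prop := forall g, F g -> le_mod I g f.

Definition is_least_upper_bound I F f : Prop :=
  is_upper_bound I F f /\ forall f', is_upper_bound I F f' -> le_mod I f f'.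

Definition is_exact_upper_bound I F f : Prop :=
  is_least_upper_bound I F f /\
  forall g, lt_mod I g f -> exists2 h, F h & lt_mod I g h.

(* A sequence of length [lambda] is a function on [ON] of which only the values
   at arguments below [lambda] matter. *)
Definition increasing_mod I (lambda : ON) (s : ON -> T -> ON) : Prop :=
  forall eta xi, eta <o xi -> xi <o lambda -> lt_mod I (s eta) (s xi).

Definition good I theta (lambda : ON) (s : ON -> T -> ON) : Prop :=
  exists2 f, is_exact_upper_bound I (s @` below lambda) f &
    I [set a | cofinality (f a) <o theta].

End Ideals.

Definition ord_prod (A : set ON) : set (A -> ON) :=
  [set f | forall a : A, f a <o val a].
Arguments ord_prod : clear implicits.

Definition directed_mod (A : set ON) (I : set (set A)) (lambda : ON) : Prop :=
  forall F : set (A -> ON), F `<=` ord_prod A -> card_smaller F lambda ->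
    exists2 h, ord_prod A h & is_upper_bound I F h.

(* Main.v *)
Require Import Defs.
From mathcomp Require Import all_boot boolp classical_sets functions cardinality.
From mathcomp Require wochoice.
Import Defs.

(* For a regular theta with kappa = theta^++ < lambda, call a sequence in prod A
   "theta-stable" if, for all sets S(a) of fewer than theta ordinals, the
   projections a |-> min (S(a) \ g_xi(a)) are eventually constant modulo I.

   Construction: g_xi is chosen by recursion to dominate all earlier g_eta and,
   for every kappa for which xi is the limit of a continuous kappa-sequence, the
   pointwise supremum of g along one such sequence e (a legitimate element of
   prod A off {a <= kappa}).

   Stability: if the projections changed unboundedly often, take a continuous
   xi : kappa -> lambda whose successive values witness changes and which is
   closed under the question "is the supremum of g along this initial segment
   of a guessing set bounded by some g_eta?".  The sequences xi and e have the
   same supremum, so they agree on a club of kappa, and club guessing gives a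
   theta-sequence c in that club; the suprema of g o xi along initial segments
   of c lie below g_sup(xi), hence are interleaved with g o xi o c modulo I.
   Now theta-regularity of I yields one coordinate a at which the projections
   to S(a) of these (everywhere nondecreasing) suprema change theta times, which
   is impossible as S(a) has fewer than theta elements.

   From stability: were there no least upper bound, one could for theta steps
   add to S(a) the value of an upper bound that improves on the current stable
   projection on a positive set; by theta-regularity some coordinate would
   then decrease infinitely often.  Exactness and cf >= theta follow by applying
   stability to S(a) = {g'(a)} and to S(a) = a cofinal subset of the least upper
   bound at a. *)

Set Implicit Arguments.
Unset Strict Implicit.
Unset Printing Implicit Defensive.

Local Open Scope classical_set_scope.
Local Open Scope card_scope.

(** * Well-orders *)

(** Recursion along [R] with the step given as a relation: [P t G u] reads [u] as an admissible
    value at [t], and locality says that only the values of [G] before [t] matter. The conclusion is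
    conditional because admissible values are found afterwards, by an induction that uses the
    properties of earlier ones. *)
Lemma wf_choice (T X : Type) (R : T -> T -> Prop) (x0 : X)
    (P : T -> (T -> X) -> X -> Prop) :
  well_founded R ->
  (forall t G G' u, (forall s, R s t -> G s = G' s) -> P t G u -> P t G' u) ->
  exists G : T -> X, forall t, (exists u, P t G u) -> P t G (G t).
Proof.
move=> wfR loc.
pose step t (rec : forall s, R s t -> X) : X :=
  let G' s := if pselect (R s t) is left h then rec s h else x0 in
  if pselect (exists u, P t G' u) is left h then projT1 (cid h) else x0.
pose G := Fix wfR (fun=> X) step.
have GE t : G t = step t (fun s _ => G s).
  rewrite /G Fix_eq // => {}t f g fg; suff -> : f = g by [].
  by apply: functional_extensionality_dep => s; apply/funext => h; exact: fg.
exists G => t [u Pu].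
pose G' s := if pselect (R s t) is left h then G s else x0.
have GG' s : R s t -> G s = G' s.
  by move=> st; rewrite /G'; case: (pselect (R s t)).
have Pu' : exists u, P t G' u by exists u; apply: loc Pu; exact: GG'.
have -> : G t = projT1 (cid Pu').
  rewrite GE /step -/G'; case: (pselect _) => // h.
  by congr (projT1 (cid _)); exact: Prop_irrelevance.
by apply: loc (projT2 (cid Pu')) => s st; exact/esym/GG'.
Qed.

Section WellOrders.
Variable W : wellOrder.
Implicit Types x y z : W.

Lemma wo_min (P : set W) :
  P !=set0 -> exists2 x, P x & forall y, P y -> wo_le x y.
Proof.
case=> x Px; have [|z [[/asboolP Pz zP] _]] := wo_leP (A := [pred y | `[< P y >]]).
  by exists x; apply/asboolP.
by exists z => // y Py; apply: zP; apply/asboolP.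
Qed.

Lemma wo_refl x : wo_le x x.
Proof. by have [|y -> ->] := wo_min (P := [set x]); first by exists x. Qed.

Lemma wo_total x y : wo_le x y || wo_le y x.
Proof.
have [|z [] -> zP] := wo_min (P := [set t | t = x \/ t = y]).
- by exists x; left.
- by rewrite zP //; right.
- by rewrite (zP x) ?orbT //; left.
Qed.

Lemma wo_anti x y : wo_le x y -> wo_le y x -> x = y.
Proof.
move=> xy yx.
have [|z [_ zU]] := wo_leP (A := [pred t | `[< t = x \/ t = y >]]).
  by exists x; apply/asboolP; left.
rewrite -(zU x) ?(zU y) //; split.
- by apply/asboolP; right.
- by move=> t /asboolP[] ->; rewrite ?wo_refl.
- by apply/asboolP; left.
- by move=> t /asboolP[] ->; rewrite ?wo_refl.
Qed.

Lemma wo_trans x y z : wo_le x y -> wo_le y z -> wo_le x z.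
Proof.
move=> xy yz; have [|t] := wo_min (P := [set t | [\/ t = x, t = y | t = z]]).
  by exists x; apply: Or31.
case=> -> tP; first by apply: tP; apply: Or33.
  by rewrite (wo_anti xy) //; apply: tP; apply: Or31.
have zy : wo_le z y by apply: tP; apply: Or32.
by rewrite -(wo_anti yz zy).
Qed.

Definition wo_lt x y : Prop := ~~ wo_le y x.

Lemma wo_ltW x y : wo_lt x y -> wo_le x y.
Proof. by rewrite /wo_lt; case/orP: (wo_total x y) => ->. Qed.

Lemma wo_leVlt x y : wo_le x y \/ wo_lt y x.
Proof. by rewrite /wo_lt; case: (wo_le x y); [left|right]. Qed.

Lemma wo_lt_irr x : ~ wo_lt x x.
Proof. by rewrite /wo_lt wo_refl. Qed.

Lemma wo_le_lt x y z : wo_le x y -> wo_lt y z -> wo_lt x z.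
Proof. by move=> xy; apply: contra => zx; apply: wo_trans xy. Qed.

Lemma wo_lt_le x y z : wo_lt x y -> wo_le y z -> wo_lt x z.
Proof. by move=> + yz; apply: contra; apply: wo_trans. Qed.

Lemma wo_le_eqVlt x y : wo_le x y -> x = y \/ wo_lt x y.
Proof.
by move=> xy; have [/(wo_anti xy)|] := wo_leVlt y x; [left | right].
Qed.

Lemma wo_lt_wf : well_founded wo_lt.
Proof.
move=> x; apply: contrapT => nx.
have [|y ny yP] := wo_min (P := [set x | ~ Acc wo_lt x]); first by exists x.
apply: ny; constructor => z zy; apply: contrapT => /yP yz.
exact: wo_lt_irr (wo_le_lt yz zy).
Qed.

Lemma mono_wo_ge (f : W -> W) x : {mono f : x y / wo_le x y} -> wo_le x (f x).
Proof.
move=> fm; case: (wo_leVlt x (f x)) => // nx.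
have [|y yP ymin] := wo_min (P := [set x | wo_lt (f x) x]); first by exists x.
have /ymin : wo_lt (f (f y)) (f y) by rewrite /wo_lt fm.
by apply/contraLR => _; exact: yP.
Qed.

End WellOrders.

(** * Embeddings, initial segments and comparability of well-orders *)

Definition wo_emb (W V : wellOrder) (f : W -> V) : Prop :=
  {mono f : x y / wo_le x y}.

Definition segment (W V : wellOrder) : Prop :=
  exists (f : W -> V) (b : V), wo_emb f /\ range f = [set y | ~~ wo_le b y].

Lemma wo_emb_inj (W V : wellOrder) (f : W -> V) : wo_emb f -> injective f.
Proof.
by move=> fm x y fxy; apply: wo_anti; rewrite -fm fxy wo_refl.
Qed.

Lemma wo_emb_lt (W V : wellOrder) (f : W -> V) :
  (forall x y, wo_lt x y -> wo_lt (f x) (f y)) -> wo_emb f.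
Proof.
move=> fm x y; apply/idP/idP => [fxy|/wo_le_eqVlt[->|/fm/wo_ltW//]].
  by case: (wo_leVlt x y) => // /fm; rewrite /wo_lt fxy.
exact: wo_refl.
Qed.

Lemma segment_no_emb (W V : wellOrder) (f : V -> W) :
  segment W V -> ~ wo_emb f.
Proof.
case=> g [b [gm gR]] fm.
have gfm : {mono (g \o f) : x y / wo_le x y} by move=> x y /=; rewrite gm fm.
have := mono_wo_ge b gfm; apply/negP.
by have : range g (g (f b)) by []; rewrite gR.
Qed.

Lemma wo_iso_emb (W V : wellOrder) :
  wo_iso W V <-> exists f : W -> V, wo_emb f /\ forall y, exists x, f x = y.
Proof.
split=> [[f [g fK gK] fm]|[f [fm fs]]].
  by exists f; split=> // y; exists (g y).
exists f => //; have [g gP] := choice fs.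
by exists g => // x; apply: (wo_emb_inj fm); rewrite gP.
Qed.

Lemma wo_iso_sym (W V : wellOrder) : wo_iso W V -> wo_iso V W.
Proof.
move=> WV; have /asboolP : wo_isob V W by rewrite wo_isob_sym; apply/asboolP.
by [].
Qed.

(** Greedy matching: [G] sends [x] to the least element of [V] above all earlier values, or to
    [None] when none is left. By [Gdown] the values form an initial segment of [V]. *)
Lemma wo_trichotomy (W V : wellOrder) : [\/ wo_iso W V, segment W V | segment V W].
Proof.
pose U (x : W) (G : W -> option V) : set V :=
  [set y | forall z v, wo_lt z x -> G z = Some v -> wo_lt v y].
pose P (x : W) G (u : option V) : Prop :=
  if u is Some y then U x G y /\ forall y', U x G y' -> wo_le y y'
  else ~ (U x G !=set0).
have loc x G G' u : (forall s, wo_lt s x -> G s = G' s) -> P x G u -> P x G' u.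
  move=> GG'; suff -> : P x G = P x G' by [].
  rewrite /P; suff -> : U x G = U x G' by [].
  by apply/seteqP; split=> y Uy z v zx; [rewrite -GG'|rewrite GG'] => //; apply: Uy.
have [G GP'] := wf_choice None (@wo_lt_wf W) loc.
have {GP'} GP x : P x G (G x).
  apply: GP'; case: (pselect (U x G !=set0)) => [U0|]; last by exists None.
  by have [y] := wo_min U0; exists (Some y).
have Gmono z z' v v' : G z = Some v -> G z' = Some v' -> wo_lt z z' -> wo_lt v v'.
  by move=> Gz Gz' zz'; have := GP z'; rewrite Gz' => -[/(_ _ _ zz' Gz)].
have Gmono' z z' v v' : G z = Some v -> G z' = Some v' -> wo_le v v' -> wo_le z z'.
  move=> Gz Gz' vv'; case: (wo_leVlt z z') => // /(Gmono _ _ _ _ Gz' Gz).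
  by rewrite /wo_lt vv'.
have Gdown z : forall v y, G z = Some v -> wo_lt y v -> exists2 z', wo_lt z' z & G z' = Some y.
  elim/(well_founded_induction (@wo_lt_wf W)): z => z IH v y Gz yv.
  have := GP z; rewrite Gz => -[_ /(_ y)] vmin.
  have : ~ U z G y by move/vmin; apply/negP.
  move/existsNP => [z' /existsNP[v' /not_implyP[z'z /not_implyP[Gz' v'y]]]].
  have /wo_le_eqVlt[->|yv'] : wo_le y v' by case: (wo_leVlt y v').
    by exists z'.
  have [z'' z''z' Gz''] := IH _ z'z _ _ Gz' yv'.
  by exists z'' => //; apply: wo_lt_le z''z' (wo_ltW z'z).
(* If [V] runs out, at a least [x0], inverting [G] embeds [V] onto the segment below [x0]; otherwise
   [G] is total and is either onto or misses a least [b]. *)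
case: (pselect (exists x, G x = None)) => [[x Gx]|GS].
  have [|{Gx}x0 Gx0 x0min] := wo_min (P := [set x | G x = None]); first by exists x.
  have Gs z : wo_lt z x0 -> exists v, G z = Some v.
    case Gz : (G z) => [v|]; first by exists v.
    by move/negP; case; apply: x0min.
  have /choice[k kP] y : exists z, wo_lt z x0 /\ G z = Some y.
    have := GP x0; rewrite Gx0 => nU.
    have : ~ U x0 G y by move=> Uy; apply: nU; exists y.
    move/existsNP => [z /existsNP[v /not_implyP[zx0 /not_implyP[Gz vy]]]].
    have /wo_le_eqVlt[yv|yv] : wo_le y v by case: (wo_leVlt y v).
      by exists z; rewrite yv.
    have [z' z'z Gz'] := Gdown _ _ _ Gz yv.
    by exists z'; split=> //; apply: wo_lt_le z'z (wo_ltW zx0).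
  apply: Or33; exists k, x0; split.
    apply: wo_emb_lt => y y' yy'.
    case: (wo_leVlt (k y') (k y)) => // /wo_le_eqVlt[kk|].
      have := (kP y').2; rewrite kk (kP y).2 => -[E].
      by move: yy'; rewrite E => /wo_lt_irr.
    move=> /(Gmono _ _ _ _ (kP y').2 (kP y).2) y'y.
    by case: (wo_lt_irr (wo_le_lt (wo_ltW yy') y'y)).
  apply/seteqP; split=> [_ [y _ <-]|z /= zx0]; first exact: (kP y).1.
  have [v Gz] := Gs z zx0; exists v => //; apply: wo_anti.
    exact: Gmono' (kP v).2 Gz (wo_refl v).
  exact: Gmono' Gz (kP v).2 (wo_refl v).
have /choice[f fP] z : exists v, G z = Some v.
  case Gz : (G z) => [v|]; first by exists v.
  by case: GS; exists z.
have fm : wo_emb f by apply: wo_emb_lt => z z'; apply: Gmono; exact: fP.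
case: (pselect (exists y, ~ range f y)) => [ny|fs].
  have [b bP bmin] := wo_min (P := [set y | ~ range f y]) ny.
  apply: Or32; exists f, b; split=> //; apply/seteqP; split=> [_ [z _ <-]|y /= yb].
    apply/negP => /wo_le_eqVlt[bf|bf]; first by apply: bP; exists z.
    have [z' _ Gz'] := Gdown _ _ _ (fP z) bf; apply: bP; exists z' => //.
    by apply: Some_inj; rewrite -fP.
  by apply: contrapT => /bmin; apply/negP.
apply: Or31; apply/wo_iso_emb; exists f; split=> // y.
by apply: contrapT => nf; apply: fs; exists y => -[z _ fz]; apply: nf; exists z.
Qed.

(** * Order types and the comparison of ordinals *)

Definition otype (W : wellOrder) : ON := (\pi_ON%qT (W : {classic wellOrder})).

Lemma otype_rep alpha : otype (wo_rep alpha) = alpha.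
Proof. exact: reprK. Qed.

Lemma otype_eq (W V : wellOrder) : otype W = otype V <-> wo_iso W V.
Proof.
split=> [/eqquotP/asboolP//|WV]; apply/eqquotP; exact/asboolP.
Qed.

Lemma rep_otype (W : wellOrder) : wo_iso (wo_rep (otype W)) W.
Proof. by apply/otype_eq; rewrite otype_rep. Qed.

Lemma segment_iso (W W' V V' : wellOrder) :
  wo_iso W W' -> wo_iso V V' -> segment W V -> segment W' V'.
Proof.
move=> /wo_iso_sym/wo_iso_emb[f [fm fs]] /wo_iso_emb[g [gm gs]] [h [b [hm hR]]].
exists (g \o h \o f), (g b); split; first by move=> x y /=; rewrite gm hm fm.
apply/seteqP; split=> [_ [x _ <-] /=|y /=].
  by rewrite gm; have : range h (h (f x)) by []; rewrite hR.
have [y' <-] := gs y; rewrite gm => y'b.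
have : range h y' by rewrite hR.
by case=> x _ <-; have [x' <-] := fs x; exists x'.
Qed.

Lemma ord_lt_otype (W V : wellOrder) : (otype W <o otype V) <-> segment W V.
Proof.
split; apply: segment_iso; try exact: rep_otype.
- exact/wo_iso_sym/rep_otype.
- exact/wo_iso_sym/rep_otype.
Qed.

Lemma ord_trichotomy (alpha beta : ON) : [\/ alpha = beta, alpha <o beta | beta <o alpha].
Proof.
rewrite -(otype_rep alpha) -(otype_rep beta).
case: (wo_trichotomy (wo_rep alpha) (wo_rep beta)) => h.
- by apply: Or31; apply/otype_eq.
- by apply: Or32; apply/ord_lt_otype.
- by apply: Or33; apply/ord_lt_otype.
Qed.

Lemma ord_lt_irr (alpha : ON) : ~ alpha <o alpha.
Proof. by move/segment_no_emb => /(_ id); apply. Qed.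

Lemma segment_trans (W V U : wellOrder) : segment W V -> segment V U -> segment W U.
Proof.
move=> WV VU; case: (wo_trichotomy W U) => // [/wo_iso_sym/wo_iso_emb|].
  case=> f [fm _]; case: VU => g [b [gm _]].
  by case: (segment_no_emb (f := f \o g) WV) => x y /=; rewrite fm gm.
case=> f [c [fm _]]; case: VU => g [b [gm _]].
by case: (segment_no_emb (f := f \o g) WV) => x y /=; rewrite fm gm.
Qed.

Lemma ord_lt_trans (beta alpha gamma : ON) :
  alpha <o beta -> beta <o gamma -> alpha <o gamma.
Proof. exact: segment_trans. Qed.

Lemma emb_ord_le (W V : wellOrder) (f : W -> V) :
  wo_emb f -> otype W <=o otype V.
Proof.
move=> fm; case: (wo_trichotomy W V) => h.
- by left; apply/otype_eq.
- by right; apply/ord_lt_otype.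
- by case: (segment_no_emb h fm).
Qed.

Lemma mk_well_order T (R : rel T) :
  (forall x y, R x y -> R y x -> x = y) ->
  (forall P : set T, P !=set0 -> exists2 x, P x & forall y, P y -> R x y) ->
  wochoice.well_order R.
Proof.
move=> Ra Rm; apply: wochoice.antisymmetric_well_order.
  by move=> x y /andP[]; exact: Ra.
move=> A [x Ax]; have [|z Az zm] := Rm [set x | x \in A]; first by exists x.
by exists z; split.
Qed.

(** * Ordinals below [alpha] as points of its representative *)

Section Segments.
Variables (alpha : ON) (b : wo_rep alpha).

Definition seg_le : rel {y : wo_rep alpha | wo_lt y b} :=
  fun x y => wo_le (sval x) (sval y).

Lemma seg_well_order : wochoice.well_order seg_le.
Proof.
apply: mk_well_order => [[x xb] [y yb] /= xy yx|P [[x xb] Px]].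
  by apply: eq_exist; exact: wo_anti.
have [|y [yb Py] ym] := wo_min (P := [set y | exists h : wo_lt y b, P (exist _ y h)]).
  by exists x; exists xb.
by exists (exist _ y yb) => // -[z zb] Pz; apply: ym; exists zb.
Qed.

Definition seg_type : ON := otype (WellOrder seg_well_order).

Lemma seg_type_lt : seg_type <o alpha.
Proof.
rewrite -[X in _ <o X]otype_rep; apply/ord_lt_otype.
exists (fun x : WellOrder seg_well_order => sval x), b; split=> //.
by apply/seteqP; split=> [_ [[x xb] _ <-]//|x xb]; exists (exist _ x xb).
Qed.

End Segments.
Arguments seg_well_order {alpha} b.

(** With [seg_type_lt] and [seg_type_mono] this identifies [below alpha] with the type
    [wo_rep alpha], which lives in the lower universe. *)
Lemma below_seg (alpha beta : ON) : beta <o alpha -> exists b : wo_rep alpha, seg_type b = beta.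
Proof.
case=> f [b [fm fR]]; exists b; rewrite -(otype_rep beta); apply/otype_eq.
apply/wo_iso_sym/wo_iso_emb.
have fb x : wo_lt (f x) b by have : range f (f x) by []; rewrite fR.
exists (fun x => exist _ (f x) (fb x) : WellOrder (seg_well_order b)).
split=> [x y|[y yb]]; first by rewrite -[RHS]fm.
have : range f y by rewrite fR.
by case=> x _ fx; exists x; apply: eq_exist.
Qed.

Lemma seg_type_mono (alpha : ON) (b c : wo_rep alpha) :
  wo_lt b c -> seg_type b <o seg_type c.
Proof.
move=> bc; apply/ord_lt_otype.
have h (x : wo_rep alpha) : wo_lt x b -> wo_lt x c.
  by move=> xb; apply: wo_lt_le xb (wo_ltW bc).
exists (fun x : WellOrder (seg_well_order b) =>
  (exist _ (sval x) (h _ (svalP x)) : WellOrder (seg_well_order c))).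
exists (exist _ b bc); split=> //.
apply/seteqP; split=> [_ [[x xb] _ <-]//|[x xc] xb].
by exists (exist _ x xb) => //; apply: eq_exist.
Qed.

Lemma seg_type_inj (alpha : ON) : injective (@seg_type alpha).
Proof.
move=> b c bc; apply: contrapT => nbc.
case: (wo_leVlt b c) => [/wo_le_eqVlt[//|]|] /seg_type_mono; rewrite bc; exact: ord_lt_irr.
Qed.

(** [P] may be a proper class, so the minimum is sought among the segments of one member [alpha]; if
    none of them is in [P], then [alpha] itself is least. *)
Lemma ord_least (P : set ON) :
  P !=set0 -> exists2 alpha, P alpha & forall beta, P beta -> alpha <=o beta.
Proof.
case=> alpha Pa.
have [[b Pb]|nb] := pselect (exists b : wo_rep alpha, P (seg_type b)).
  have [|c Pc cm] := wo_min (P := [set b : wo_rep alpha | P (seg_type b)]); first by exists b.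
  exists (seg_type c) => // beta Pbeta.
  case: (ord_trichotomy (seg_type c) beta) => [->||bc]; [by left|by right|].
  have [d dE] := below_seg (ord_lt_trans bc (seg_type_lt c)).
  have /cm : P (seg_type d) by rewrite dE.
  case/wo_le_eqVlt => [cd|/seg_type_mono]; first by left; rewrite cd.
  by rewrite dE => h; right.
exists alpha => // beta Pbeta.
case: (ord_trichotomy alpha beta) => [->||/below_seg[c cE]]; [by left|by right|].
by case: nb; exists c; rewrite cE.
Qed.

(** * Ordinals *)

Lemma ord_leVlt (alpha beta : ON) : alpha <=o beta \/ beta <o alpha.
Proof.
case: (ord_trichotomy alpha beta) => [->|h|h].
- by left; left.
- by left; right.
- by right.
Qed.

Lemma ord_ltW (alpha beta : ON) : alpha <o beta -> alpha <=o beta.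
Proof. by right. Qed.

Lemma ord_lt_le_trans (beta alpha gamma : ON) :
  alpha <o beta -> beta <=o gamma -> alpha <o gamma.
Proof. by move=> ab [<-//|]; exact: ord_lt_trans. Qed.

Lemma ord_le_lt_trans (beta alpha gamma : ON) :
  alpha <=o beta -> beta <o gamma -> alpha <o gamma.
Proof. by case=> [->//|]; exact: ord_lt_trans. Qed.

Lemma ord_le_trans (beta alpha gamma : ON) :
  alpha <=o beta -> beta <=o gamma -> alpha <=o gamma.
Proof. by case=> [->//|ab bc]; right; apply: ord_lt_le_trans bc. Qed.

Lemma ord_lt_nle (alpha beta : ON) : alpha <o beta -> ~ beta <=o alpha.
Proof. by move=> ab ba; apply: (@ord_lt_irr alpha); apply: ord_lt_le_trans ba. Qed.

Lemma ord_nle_lt (alpha beta : ON) : ~ beta <=o alpha -> alpha <o beta.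
Proof. by case: (ord_leVlt beta alpha). Qed.

Lemma ord_nlt_le (alpha beta : ON) : ~ beta <o alpha -> alpha <=o beta.
Proof. by case: (ord_leVlt alpha beta). Qed.

Lemma ord_le_anti (alpha beta : ON) : alpha <=o beta -> beta <=o alpha -> alpha = beta.
Proof. by case=> // ab /(ord_lt_nle ab). Qed.

Lemma ord_minP (P : set ON) : P !=set0 ->
  P (ord_min P) /\ forall beta, P beta -> ord_min P <=o beta.
Proof.
move=> /ord_least[alpha Pa am].
by rewrite /ord_min; case: xgetP => [x _ []//|/(_ alpha)[]].
Qed.

Lemma ord_min_le (P : set ON) beta : P beta -> ord_min P <=o beta.
Proof. by move=> Pb; have [|_] := @ord_minP P; [exists beta | apply]. Qed.

Lemma ord_lt_wf : well_founded ord_lt.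
Proof.
move=> x; apply: contrapT => nx.
have [|y ny yP] := @ord_least [set x | ~ Acc ord_lt x]; first by exists x.
apply: ny; constructor => z zy; apply: contrapT => /yP; exact: ord_lt_nle.
Qed.

Lemma ord_ind (P : ON -> Prop) :
  (forall alpha, (forall beta, beta <o alpha -> P beta) -> P alpha) ->
  forall alpha, P alpha.
Proof. exact: (well_founded_induction ord_lt_wf). Qed.

Lemma transfinite_choice (X : Type) (x0 : X) (P : ON -> (ON -> X) -> X -> Prop) :
  (forall xi G G' u, (forall eta, eta <o xi -> G eta = G' eta) ->
     P xi G u -> P xi G' u) ->
  exists G : ON -> X, forall xi, (exists u, P xi G u) -> P xi G (G xi).
Proof. exact: wf_choice x0 _ ord_lt_wf. Qed.

(** * Bounds of small families, and successors *)

Section Bounding.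
Variables (J : Type) (F : J -> ON).

Let R : rel J := sval (wochoice.well_ordering_principle {classic J}).
Let RP : @wochoice.well_order J R := svalP (wochoice.well_ordering_principle {classic J}).
Let JW : wellOrder := WellOrder RP.

Definition sum_le : rel {j : J & wo_rep (F j)} := fun p q =>
  match pselect (tag p = tag q) with
  | left e => wo_le (eq_rect _ (fun j => wo_rep (F j)) (tagged p) _ e) (tagged q)
  | right _ => R (tag p) (tag q)
  end.

Lemma sum_le_tagged (j : J) (x y : wo_rep (F j)) :
  sum_le (existT _ j x) (existT _ j y) = wo_le x y.
Proof. by rewrite /sum_le /=; case: (pselect _) => // e; rewrite (Prop_irrelevance e erefl). Qed.

Lemma sum_well_order : wochoice.well_order sum_le.
Proof.
apply: mk_well_order => [[j x] [k y]|P [[j x] Px]].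
  have [jk|jk] := pselect (j = k).
    by case: _ / jk y => y; rewrite !sum_le_tagged => xy yx; rewrite (wo_anti xy yx).
  rewrite /sum_le /=; case: (pselect _) => // _; case: (pselect _) => [/esym//|_].
  by move=> Rjk Rkj; case: jk; exact: (@wo_anti JW).
have [|k [y Py] km] := @wo_min JW [set k | exists y, P (existT _ k y)].
  by exists j, x.
have [|z Pz zm] := wo_min (P := [set y | P (existT (fun j => wo_rep (F j)) k y)]).
  by exists y.
exists (existT _ k z) => // -[l w] Pw.
have [kl|kl] := pselect (k = l).
  by case: _ / kl w Pw => w Pw; rewrite sum_le_tagged; exact: zm.
rewrite /sum_le /=; case: (pselect _) => // _; apply: km; by exists w.
Qed.

(** Each [F j] embeds into the ordered sum along a well-order of [J]; as [J] lives in the lower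
    universe, that sum has an order type in [ON]. *)
Lemma bounded_family_le : exists gamma, forall j, F j <=o gamma.
Proof.
exists (otype (WellOrder sum_well_order)) => j.
rewrite -(otype_rep (F j)).
apply: (emb_ord_le (f := fun x => existT _ j x : WellOrder sum_well_order)).
by move=> x y; exact: sum_le_tagged.
Qed.

End Bounding.

Section Top.
Variable W : wellOrder.

Definition top_le : rel (option W) := fun x y =>
  match x, y with
  | Some x, Some y => wo_le x y
  | None, Some _ => false
  | _, None => true
  end.

Lemma top_well_order : wochoice.well_order top_le.
Proof.
apply: mk_well_order => [[x|] [y|] //= xy yx|P [p Pp]]; first by rewrite (wo_anti xy yx).
have [Ps|Ps] := pselect (exists x, P (Some x)).
  have [z Pz zm] := wo_min (P := [set x | P (Some x)]) Ps.
  by exists (Some z) => // -[y|//]; exact: zm.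
case: p Pp => [x Px|PN]; first by case: Ps; exists x.
by exists None => // -[y Py|//]; case: Ps; exists y.
Qed.

Lemma otype_lt_top : otype W <o otype (WellOrder top_well_order).
Proof.
apply/ord_lt_otype; exists (Some : W -> WellOrder top_well_order), None; split=> //.
by apply/seteqP; split=> [_ [x _ <-]//|[x|//] _]; exists x.
Qed.

End Top.

Lemma ord_unbounded (alpha : ON) : exists beta, alpha <o beta.
Proof. by have := otype_lt_top (wo_rep alpha); rewrite otype_rep; eexists; eassumption. Qed.

Lemma bounded_family (J : Type) (F : J -> ON) : exists gamma, forall j, F j <o gamma.
Proof.
have [gamma gP] := bounded_family_le F; have [beta gb] := ord_unbounded gamma.
by exists beta => j; apply: ord_le_lt_trans gb.
Qed.

(** A form of replacement: reindexing by [wo_rep alpha] makes the family small enough for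
    [bounded_family]. *)
Lemma below_bounded (alpha : ON) (F : ON -> ON) :
  exists gamma, forall beta, beta <o alpha -> F beta <o gamma.
Proof.
have [gamma gP] := bounded_family (fun b : wo_rep alpha => F (seg_type b)).
by exists gamma => beta /below_seg[b <-].
Qed.

Lemma ord_succ_lt (alpha : ON) : alpha <o ord_succ alpha.
Proof. exact: (ord_minP (ord_unbounded alpha)).1. Qed.

Lemma ord_succ_le (alpha beta : ON) : alpha <o beta -> ord_succ alpha <=o beta.
Proof. exact: (ord_minP (ord_unbounded alpha)).2. Qed.

Lemma ord_lt_succ (alpha beta : ON) : alpha <o ord_succ beta <-> alpha <=o beta.
Proof.
split=> [ab|ab]; last by apply: ord_le_lt_trans ab _; exact: ord_succ_lt.
by apply: ord_nlt_le => /ord_succ_le; apply: ord_lt_nle.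
Qed.

Lemma ord_succ_inj : injective ord_succ.
Proof.
move=> a b ab; apply: ord_le_anti; apply/ord_lt_succ.
  by rewrite -ab; exact: ord_succ_lt.
by rewrite ab; exact: ord_succ_lt.
Qed.

Lemma ord0_le (alpha : ON) : ord0 <=o alpha.
Proof.
rewrite -(otype_rep alpha).
by apply: (emb_ord_le (W := WellOrder void_well_order) (f := fun x : void => match x with end)) => -[].
Qed.

Lemma ord_lt0 (alpha : ON) : ~ alpha <o ord0.
Proof. by move/ord_lt_nle; apply; exact: ord0_le. Qed.

Lemma card_leI T U (f : T -> U) (X : set T) (Y : set U) :
  (forall x, X x -> Y (f x)) ->
  (forall x y, X x -> X y -> f x = f y -> x = y) -> X #<= Y.
Proof.
move=> fXY finj; have [F] : $|{injfun X >-> Y}|.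
  apply/injfunPex; exists f => //.
  by move=> x y /set_mem Xx /set_mem Xy; exact: finj.
exact: inj_card_le F.
Qed.

Lemma card_leE T U (X : set T) (Y : set U) (u0 : U) : X #<= Y ->
  exists f : T -> U, (forall x, X x -> Y (f x)) /\
    (forall x y, X x -> X y -> f x = f y -> x = y).
Proof.
move=> /card_leP[g].
exists (fun t => if pselect (X t) is left h then val (g (SigSub (mem_set h))) else u0).
split=> [t Xt|t t' Xt Xt'].
  by case: (pselect (X t)) => // h; exact: set_valP.
case: (pselect (X t)) => // h; case: (pselect (X t')) => // h' /val_inj.
by move/(inj (f := g)) => /(_ (mem_setT _) (mem_setT _)) [].
Qed.

(** * Cardinals *)

(* Regularity without reference to cofinalities, for infinite ordinals. *)
Definition is_reg (kappa : ON) : Prop :=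
  [/\ ord0 <o kappa,
      (forall d, d <o kappa -> ord_succ d <o kappa) &
      (forall b (h : ON -> ON), b <o kappa -> (forall d, d <o b -> h d <o kappa) ->
         exists2 g, g <o kappa & forall d, d <o b -> h d <o g)].

Lemma card_below (alpha beta : ON) : alpha <=o beta -> below alpha #<= below beta.
Proof.
move=> ab; apply: (card_leI (f := id)) => // x xa; exact: ord_lt_le_trans ab.
Qed.

Lemma card_setX T U T' U' (X : set T) (Y : set U) (X' : set T') (Y' : set U')
    (x0 : T') (y0 : U') :
  X #<= X' -> Y #<= Y' -> X `*` Y #<= X' `*` Y'.
Proof.
move=> /(card_leE x0)[f [fX fi]] /(card_leE y0)[g [gY gi]].
apply: (card_leI (f := fun p => (f p.1, g p.2))) => [[x y] [/fX ? /gY ?]|] //.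
by move=> [x y] [x' y'] /= [Xx Yy] [Xx' Yy'] [] /fi -> // /gi ->.
Qed.

(** Hilbert's hotel: a new point [x] goes to [n 0] in a sequence of distinct points of [X], each
    [n k] moves to [n k.+1], and all else stays. *)
Lemma card_le_setU1 T (X : set T) (x : T) : infinite_set X -> x |` X #<= X.
Proof.
move=> iX; have [Xx|nXx] := pselect (X x).
  by apply: (card_leI (f := id)) => // y [->|].
have [n nXi] : exists n : nat -> T, (forall k, X (n k)) /\ injective n.
  have /infiniteP/(card_leE x)[n [nX ni]] := iX.
  by exists n; split=> [k|k l /ni]; [exact: nX | exact].
have [nX ni] := nXi.
pose f y := if pselect (y = x) then n 0 else
  if pselect (exists k, y = n k) is left h then n (projT1 (cid h)).+1 else y.
have fx : f x = n 0 by rewrite /f; case: (pselect _).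
have nx k : n k <> x by move=> nkx; apply: nXx; rewrite -nkx.
have fn k : f (n k) = n k.+1.
  rewrite /f; case: (pselect (n k = x)) => [/nx//|?].
  case: (pselect (exists l, n k = n l)) => [h|[]]; last by exists k.
  by congr (n _.+1); apply/esym/ni; exact: (projT2 (cid h)).
have fo y : y <> x -> (forall k, y <> n k) -> f y = y.
  move=> yx yn; rewrite /f; case: (pselect (y = x)) => // ?.
  case: (pselect (exists k, y = n k)) => // h.
  by case: (yn _ (projT2 (cid h))).
have cases y : [\/ y = x, exists k, y = n k | y <> x /\ forall k, y <> n k].
  have [|yx] := pselect (y = x); first by constructor 1.
  have [|yn] := pselect (exists k, y = n k); first by constructor 2.
  by constructor 3; split=> // k ykk; apply: yn; exists k.
apply: (card_leI (f := f)) => [y [->|Xy]|y z _ _].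
- by rewrite fx.
- case: (cases y) => [->|[k ->]|[yx yn]]; rewrite ?fx ?fn ?fo //.
case: (cases y) => [->|[k ->]|[yx yn]]; case: (cases z) => [->|[l ->]|[zx zn]];
  rewrite ?fx ?fn ?(fo y) ?(fo z) //.
- by move/ni.
- by move=> e; case: (zn 0).
- by move/ni.
- by move/ni => [->].
- by move=> e; case: (zn k.+1).
- by move/esym => e; case: (yn 0).
- by move/esym => e; case: (yn l.+1).
Qed.

(** Otherwise [below kappa] would lie in [below d] plus the point [d], which is no larger than
    [below d]. *)
Lemma infinite_cardinal_succ (kappa d : ON) :
  is_cardinal kappa -> infinite_set (below kappa) -> d <o kappa -> ord_succ d <o kappa.
Proof.
move=> kc ki dk; case: (ord_leVlt kappa (ord_succ d)) => // ks.
case: (kc _ dk); have sub : below kappa `<=` d |` below d.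
  by move=> x /(fun h => ord_lt_le_trans h ks)/ord_lt_succ; case; [left|right].
have infd : infinite_set (below d).
  move=> fd; apply: ki; apply: sub_finite_set sub _.
  by rewrite finite_setU; split.
by apply: card_le_trans (card_le_setU1 d infd); apply: (card_leI (f := id)).
Qed.

(** An ordinal that injects into [W] is determined by its image and the order copied onto it. Such
    pairs form a small type, so some [gamma] exceeds all these ordinals; an injection of [gamma]
    would make it one of them. *)
Lemma ord_hartogs (alpha : ON) : exists gamma, ~ (below gamma #<= below alpha).
Proof.
pose W := wo_rep alpha.
pose D (j : (W -> Prop) * (W -> W -> bool)) : set ON :=
  [set beta | exists i : wo_rep beta -> W,
     (forall w, j.1 w <-> exists x, i x = w) /\ forall x y, j.2 (i x) (i y) = wo_le x y].
have [gamma gP] := bounded_family (fun j => xget ord0 (D j)).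
exists gamma => /(card_leE ord0)[f [fg fi]].
have /choice[i iP] (x : wo_rep gamma) : exists w : W, seg_type w = f (seg_type x).
  by apply: below_seg; apply: fg; exact: seg_type_lt.
have ii : injective i.
  move=> x y xy; apply: (@seg_type_inj gamma); apply: fi; try exact: seg_type_lt.
  by rewrite -!iP xy.
pose j : (W -> Prop) * (W -> W -> bool) := (fun w => exists x, i x = w,
  fun w w' => `[< exists x y, [/\ w = i x, w' = i y & wo_le x y] >]).
have jE x y : j.2 (i x) (i y) = wo_le x y.
  by apply/asboolP/idP => [[x' [y' [/ii -> /ii ->]]]//|xy]; exists x, y.
have Dg : D j gamma by exists i.
have := gP j; case: xgetP => [beta _ [i' [iR iE]]|/(_ gamma)//].
suff -> : beta = gamma by apply: ord_lt_irr.
rewrite -(otype_rep beta) -(otype_rep gamma); apply/otype_eq/wo_iso_sym/wo_iso_emb.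
have /choice[k kP] (x : wo_rep gamma) : exists y, i' y = i x.
  by apply/iR; exists x.
exists k; split=> [x y|y]; first by rewrite -iE !kP jE.
have /iR[x ix] : exists y', i' y' = i' y by exists y.
by exists x; apply: wo_anti; rewrite -iE kP ix iE wo_refl.
Qed.

Lemma least_equinumerous (alpha : ON) :
  exists c, [/\ is_cardinal c, c <=o alpha & below alpha #<= below c].
Proof.
have [|c cP cm] := @ord_least [set c | below alpha #<= below c].
  by exists alpha; exact: card_lexx.
exists c; split=> //; last by apply: cm; exact: card_lexx.
by move=> e ec /(card_le_trans cP) /cm; exact: ord_lt_nle.
Qed.

Lemma card_succP (theta : ON) :
  [/\ is_cardinal (card_succ theta), theta <o card_succ theta &
      forall alpha, alpha <o card_succ theta -> below alpha #<= below theta].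
Proof.
have [|[c1 c2] cm] := @ord_minP [set mu | is_cardinal mu /\ theta <o mu].
  have [gamma gP] := ord_hartogs theta; have [c [cc _ gc]] := least_equinumerous gamma.
  exists c; split=> //; apply: ord_nle_lt => /card_below ct; apply: gP.
  exact: card_le_trans ct.
split=> // alpha at_; have [c [cc ca ac]] := least_equinumerous alpha.
apply: (card_le_trans ac); apply: card_below; apply: ord_nlt_le => tc.
by apply: (ord_lt_nle at_); apply: ord_le_trans ca; apply: cm.
Qed.

(** * Goedel's pairing order and squares of infinite ordinals *)

Section Goedel.
Variable W : wellOrder.

Definition wo_max (p : W * W) : W := if wo_le p.1 p.2 then p.2 else p.1.

(** Maxima are compared first, then the coordinates lexicographically, so that all predecessors of a
    pair lie in a square bounded by its maximum. *)
Definition goedel_le : rel (W * W) := fun p q =>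
  `[< [\/ wo_lt (wo_max p) (wo_max q),
         wo_max p = wo_max q /\ wo_lt p.1 q.1 |
         [/\ wo_max p = wo_max q, p.1 = q.1 & wo_le p.2 q.2] ] >].

Lemma goedel_well_order : wochoice.well_order goedel_le.
Proof.
apply: mk_well_order => [p q /asboolP pq /asboolP qp|P [p0 Pp0]].
  case: pq => [pq|[pq1 pq]|[pq1 pq2 pq3]]; case: qp => [qp|[qp1 qp]|[qp1 qp2 qp3]].
  - by case: (wo_lt_irr (wo_le_lt (wo_ltW pq) qp)).
  - by move: pq; rewrite qp1 => /wo_lt_irr.
  - by move: pq; rewrite qp1 => /wo_lt_irr.
  - by move: qp; rewrite pq1 => /wo_lt_irr.
  - by case: (wo_lt_irr (wo_le_lt (wo_ltW pq) qp)).
  - by move: pq; rewrite qp2 => /wo_lt_irr.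
  - by move: qp; rewrite pq1 => /wo_lt_irr.
  - by move: qp; rewrite pq2 => /wo_lt_irr.
  - by case: p q pq2 pq3 qp3 {pq1 qp1 qp2} => [x y] [x' y'] /= -> h1 h2; rewrite (wo_anti h1 h2).
have [|m [p1 [Pp1 m1]] mm] := wo_min (P := [set m | exists p, P p /\ wo_max p = m]).
  by exists (wo_max p0), p0.
have [|x [p2 [Pp2 m2 x2]] xm] :=
    wo_min (P := [set x | exists p, [/\ P p, wo_max p = m & p.1 = x]]).
  by exists p1.1, p1.
have [|y [p3 [Pp3 m3 x3 y3]] ym] :=
    wo_min (P := [set y | exists p, [/\ P p, wo_max p = m, p.1 = x & p.2 = y]]).
  by exists p2.2, p2.
exists p3 => // q Pq; apply/asboolP.
have /wo_le_eqVlt[mq|mq] : wo_le m (wo_max q) by apply: mm; exists q.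
  have /wo_le_eqVlt[xq|xq] : wo_le x q.1 by apply: xm; exists q.
    by apply: Or33; rewrite m3 x3 y3; split=> //; apply: ym; exists q.
  by apply: Or32; rewrite m3 x3.
by apply: Or31; rewrite m3.
Qed.

Lemma goedel_lt_max (p q : W * W) :
  ~~ goedel_le q p -> wo_le p.1 (wo_max q) /\ wo_le p.2 (wo_max q).
Proof.
move=> /negP qp.
have pq : wo_le (wo_max p) (wo_max q).
  by case: (wo_leVlt (wo_max p) (wo_max q)) => // h; case: qp; apply/asboolP; apply: Or31.
have : wo_le p.1 (wo_max p) /\ wo_le p.2 (wo_max p).
  rewrite /wo_max; case: ifPn => [h|/wo_ltW h]; split=> //; exact: wo_refl.
by case=> h1 h2; split; [apply: wo_trans h1 pq|apply: wo_trans h2 pq].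
Qed.

End Goedel.

Lemma card_rep (alpha : ON) : [set: wo_rep alpha] #<= below alpha /\
  below alpha #<= [set: wo_rep alpha].
Proof.
split.
  apply: (card_leI (f := @seg_type alpha)) => [x _|x y _ _ /seg_type_inj//].
  exact: seg_type_lt.
have [->|/set0P[b0 b0a]] := eqVneq (below alpha) set0; first exact: card_ge0.
have [w0 _] := below_seg b0a.
have /choice[k kP] (b : ON) : exists w : wo_rep alpha, b <o alpha -> seg_type w = b.
  by have [/below_seg[w wb]|nb] := pselect (b <o alpha); [exists w|exists w0].
apply: (card_leI (f := k)) => // x y xa ya kxy.
by rewrite -(kP x xa) -(kP y ya) kxy.
Qed.

(** For a cardinal [alpha], compare the pairing order on its square with [alpha]. If it were longer,
    a proper segment would be a copy of [alpha] inside the square of some [gamma] below [alpha],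
    which is too small by induction. *)
Lemma card_square (alpha : ON) : infinite_set (below alpha) ->
  below alpha `*` below alpha #<= below alpha.
Proof.
elim/ord_ind: alpha => alpha IH ia.
have [[beta ba ab]|nc] := pselect (exists2 beta, beta <o alpha & below alpha #<= below beta).
  have ib : infinite_set (below beta) by move=> fb; apply: ia; exact: card_le_finite fb.
  apply: card_le_trans (card_setX ord0 ord0 ab ab) _.
  by apply: card_le_trans (IH _ ba ib) (card_below (ord_ltW ba)).
have ca : is_cardinal alpha by move=> beta ba ab; apply: nc; exists beta.
pose W := wo_rep alpha; pose T := WellOrder (goedel_well_order (W := W)).
have [[r1 r2]] := card_rep alpha.
have [w0 _] : exists w : W, True.
  apply: contrapT => nw; apply: ia; apply: card_le_finite r2 _.
  by rewrite (_ : [set: _] = set0) // -subset0 => w _; apply: nw; exists w.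
have conc (f : T -> W) : injective f -> below alpha `*` below alpha #<= below alpha.
  move=> fi; apply: card_le_trans (card_setX w0 w0 r2 r2) _.
  by apply: card_le_trans r1; apply: (card_leI (f := f)) => // x y _ _ /fi.
case: (wo_trichotomy T W) => [[f /bij_inj fi _]|[f [b [/wo_emb_inj fi _]]]|].
- exact: conc fi.
- exact: conc fi.
case=> f [b [/wo_emb_inj fi fR]].
pose m := wo_max b; pose gamma := ord_succ (seg_type m).
have ga : gamma <o alpha by apply: infinite_cardinal_succ => //; exact: seg_type_lt.
have leg (x : W) : wo_le x m -> seg_type x <o gamma.
  by move=> xm; apply/ord_lt_succ; case: (wo_le_eqVlt xm) => [->|/seg_type_mono]; [left|right].
have ag : below alpha #<= below gamma `*` below gamma.
  apply: card_le_trans r2 _.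
  apply: (card_leI (f := fun x => (seg_type (f x).1, seg_type (f x).2))) => [x _|x y _ _].
    have : range f (f x) by []; rewrite fR => /goedel_lt_max[h1 h2].
    by split=> /=; exact: leg.
  move=> [] /seg_type_inj h1 /seg_type_inj h2; apply: fi; move: h1 h2.
  by case: (f x) => ? ?; case: (f y) => ? ? /= -> ->.
have [fg|ig] := pselect (finite_set (below gamma)).
  by case: ia; apply: card_le_finite ag _; exact: finite_setX.
by case: (ca _ ga); apply: card_le_trans ag (IH _ ga ig).
Qed.

(** An unbounded [h] on [b] would cover [mu] by at most [theta] pieces of size at most [theta];
    choosing a piece [d g] for each [g] injects [mu] into the square of [theta], hence into
    [theta]. *)
Lemma card_succ_reg (theta : ON) : infinite_set (below theta) -> is_reg (card_succ theta).
Proof.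
move=> it; have [cc tc csP] := card_succP theta; set mu := card_succ theta in cc tc csP *.
have im : infinite_set (below mu).
  by move=> fm; apply: it; exact: card_le_finite (card_below (ord_ltW tc)) fm.
have lim := infinite_cardinal_succ cc im.
split=> //; first by apply: ord_le_lt_trans tc; exact: ord0_le.
move=> b h bm hm; apply: contrapT => nb; apply: (cc _ tc).
have /choice[d dP] (g : ON) : exists d, g <o mu -> d <o b /\ g <o ord_succ (h d).
  have [gm|] := pselect (g <o mu); last by exists ord0.
  apply: contrapT => nd; apply: nb; exists g => // e eb; apply: ord_nle_lt => /ord_lt_succ ge.
  by apply: nd; exists e.
have /choice[i iP] (e : ON) : exists i : ON -> ON, e <o b ->
    (forall x, x <o ord_succ (h e) -> i x <o theta) /\
    (forall x y, x <o ord_succ (h e) -> y <o ord_succ (h e) -> i x = i y -> x = y).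
  have [/hm/lim/csP/(card_leE ord0)[i iP]|] := pselect (e <o b); last by exists id.
  by exists i.
have bt : below b `*` below theta #<= below theta.
  apply: card_le_trans (card_square it); apply: card_setX ord0 ord0 _ (card_lexx _).
  exact: csP.
apply: card_le_trans bt.
apply: (card_leI (f := fun g => (d g, i (d g) g))) => [g gm|g g' gm gm' [dd]].
  have [db gd] := dP g gm; split=> //=; exact: (iP _ db).1.
have [db gd] := dP g gm; have [_ gd'] := dP g' gm'.
by rewrite -dd; apply: (iP _ db).2; rewrite // dd.
Qed.

(** * Cofinality and the bounding form of regularity *)

Lemma cofinality_le (alpha beta : ON) (h : ON -> ON) :
  (forall delta, delta <o beta -> h delta <o alpha) ->
  (forall gamma, gamma <o alpha -> exists2 delta, delta <o beta & gamma <=o h delta) ->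
  cofinality alpha <=o beta.
Proof. by move=> h1 h2; apply: ord_min_le; exists h. Qed.

Lemma cofinalityP (alpha : ON) : exists h : ON -> ON,
  (forall delta, delta <o cofinality alpha -> h delta <o alpha) /\
  (forall gamma, gamma <o alpha ->
     exists2 delta, delta <o cofinality alpha & gamma <=o h delta).
Proof.
rewrite /cofinality; set P := (X in ord_min X).
have /ord_minP[] // : P !=set0.
by exists alpha, id; split=> // gamma ga; exists gamma => //; left.
Qed.

Lemma regular_cardinal_reg (kappa : ON) : is_regular_cardinal kappa -> is_reg kappa.
Proof.
case=> [ck ik cfk]; split.
- apply: ord_nle_lt => k0; apply: ik; rewrite (_ : below kappa = set0) //.
  by rewrite -subset0 => x xk; apply: (@ord_lt0 x); apply: ord_lt_le_trans k0.
- by move=> d; exact: infinite_cardinal_succ.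
move=> b h bk hk; apply: contrapT => nb; apply: (ord_lt_nle bk); rewrite -cfk.
apply: (cofinality_le (h := h)) => // g gk; apply: contrapT => nd; apply: nb.
exists g => // d db; apply: ord_nle_lt => gd; by apply: nd; exists d.
Qed.

(** * Clubs and club guessing *)

Definition ord_join (alpha beta : ON) : ON := if `[< alpha <=o beta >] then beta else alpha.

Lemma ord_join_lt (alpha beta gamma : ON) :
  alpha <o gamma -> beta <o gamma -> ord_join alpha beta <o gamma.
Proof. by rewrite /ord_join; case: asboolP. Qed.

Lemma ord_le_joinl (alpha beta : ON) : alpha <=o ord_join alpha beta.
Proof. by rewrite /ord_join; case: asboolP => // _; left. Qed.

Lemma ord_le_joinr (alpha beta : ON) : beta <=o ord_join alpha beta.
Proof. by rewrite /ord_join; case: asboolP => [_|/ord_nle_lt ?]; [left|right]. Qed.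

Definition ord_sup (b : ON) (h : ON -> ON) : ON :=
  ord_min [set g | forall d, d <o b -> h d <=o g].

Lemma ord_supP (b : ON) (h : ON -> ON) :
  (forall d, d <o b -> h d <=o ord_sup b h) /\
  (forall g, (forall d, d <o b -> h d <=o g) -> ord_sup b h <=o g).
Proof.
apply: (@ord_minP [set g | forall d, d <o b -> h d <=o g]).
by have [g gP] := below_bounded b h; exists g => d /gP; right.
Qed.

Lemma ord_sup_ge (b : ON) (h : ON -> ON) d : d <o b -> h d <=o ord_sup b h.
Proof. exact: (ord_supP b h).1. Qed.

Lemma ord_sup_le (b : ON) (h : ON -> ON) g :
  (forall d, d <o b -> h d <=o g) -> ord_sup b h <=o g.
Proof. exact: (ord_supP b h).2. Qed.

Lemma lt_ord_sup (b : ON) (h : ON -> ON) g :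
  g <o ord_sup b h -> exists2 d, d <o b & g <o h d.
Proof.
move=> gs; apply: contrapT => nd; apply: (ord_lt_nle gs); apply: ord_sup_le => d db.
by apply: ord_nlt_le => gd; apply: nd; exists d.
Qed.

Lemma ord_sup_lt_reg (kappa b : ON) (h : ON -> ON) : is_reg kappa -> b <o kappa ->
  (forall d, d <o b -> h d <o kappa) -> ord_sup b h <o kappa.
Proof.
case=> _ _ kb bk /(kb _ _ bk)[g gk hg]; apply: ord_le_lt_trans gk.
by apply: ord_sup_le => d /hg; right.
Qed.

(** The common source of closure points: each [x k] exceeds [F] of all earlier terms, so [F] of
    every term stays below the supremum [delta], and regularity keeps [delta] below [kappa]. *)
Lemma closure_sequence (theta kappa : ON) (F : ON -> ON) j :
  is_reg theta -> is_reg kappa -> theta <o kappa ->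
  (forall x, x <o kappa -> F x <o kappa) -> j <o kappa ->
  exists x : ON -> ON, exists delta, [/\ delta <o kappa,
    forall k, k <o theta -> j <o x k /\ x k <o delta,
    forall k l, l <o k -> k <o theta -> x l <o x k /\ F (x l) <o x k &
    forall g, g <o delta -> exists2 k, k <o theta & g <o x k].
Proof.
move=> [t0 ts _] kr tk Fk jk; have [k0 ks kb] := kr.
pose P k (G : ON -> ON) u := [/\ u <o kappa, j <o u & forall l, l <o k -> G l <o u /\ F (G l) <o u].
have loc k G G' u : (forall l, l <o k -> G l = G' l) -> P k G u -> P k G' u.
  by move=> GG' [uk ju Pu]; split=> // l lk; rewrite -GG' //; exact: Pu.
have [x xP'] := transfinite_choice ord0 loc.
have {xP'} xP k : k <o theta -> P k x (x k).
  elim/ord_ind: k => k IH kt; apply: xP'.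
  have xk l : l <o k -> x l <o kappa by move=> lk; case: (IH l lk (ord_lt_trans lk kt)).
  have kk := ord_lt_trans kt tk.
  have [g gk gP] := kb k (fun l => ord_join (x l) (F (x l))) kk
    (fun l lk => ord_join_lt (xk l lk) (Fk _ (xk l lk))).
  exists (ord_join (ord_succ j) g); split.
  - by apply: ord_join_lt => //; exact: ks.
  - by apply: ord_lt_le_trans (ord_succ_lt j) (ord_le_joinl _ _).
  - move=> l lk; have h := ord_lt_le_trans (gP l lk) (ord_le_joinr (ord_succ j) g).
    by split; [exact: ord_le_lt_trans (ord_le_joinl _ _) h|exact: ord_le_lt_trans (ord_le_joinr _ _) h].
have mono k l : l <o k -> k <o theta -> x l <o x k /\ F (x l) <o x k.
  by move=> lk /xP[_ _]; exact.
exists x, (ord_sup theta x); split=> // [|k kt|g /lt_ord_sup//].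
- by apply: ord_sup_lt_reg => // k /xP[].
- have [_ jx _] := xP k kt; split=> //.
  apply: ord_lt_le_trans (mono _ _ (ord_succ_lt k) (ts _ kt)).1 _.
  by apply: ord_sup_ge; exact: ts.
Qed.

(* The hypothesis of the closure clause is vacuous at [d = ord0], so a club
   contains [ord0]; this is what makes [club_floor] below total. *)
Definition club (kappa : ON) (E : set ON) : Prop :=
  [/\ forall x, E x -> x <o kappa,
      forall d, d <o kappa ->
        (forall g, g <o d -> exists x, [/\ E x, g <o x & x <=o d]) -> E d &
      forall g, g <o kappa -> exists2 x, E x & g <o x].

(** For unboundedness, [F] bounds the next elements of all [E i] beyond a point, so the supremum of
    a sequence closed under [F] is a limit of every [E i]. *)
Lemma club_bigcap (theta kappa b : ON) (E : ON -> set ON) :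
  is_reg theta -> is_reg kappa -> theta <o kappa -> b <o kappa ->
  (forall i, i <o b -> club kappa (E i)) ->
  club kappa [set x | x <o kappa /\ forall i, i <o b -> E i x].
Proof.
move=> tr kr tk bk Ec; have [k0 ks kb] := kr; split=> [x []//|d dk dP|j jk].
  split=> // i ib; have [_ cl _] := Ec i ib; apply: cl => // g /dP[x [[_ /(_ i ib) Ex] gx xd]].
  by exists x.
have /choice[nx nxP] i : exists nx : ON -> ON,
    forall g, g <o kappa -> i <o b -> E i (nx g) /\ g <o nx g.
  have /choice[nx nxP] g : exists y, g <o kappa -> i <o b -> E i y /\ g <o y.
    have [[gk ib]|nh] := pselect (g <o kappa /\ i <o b); last first.
      by exists ord0 => gk ib; case: nh.
    by have [_ _ /(_ g gk)[y]] := Ec i ib; exists y.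
  by exists nx.
have /choice[F FP] g : exists y, g <o kappa -> y <o kappa /\ forall i, i <o b -> nx i g <o y.
  have [gk|] := pselect (g <o kappa); last by exists ord0.
  have [i ib|y yk yP] := kb b (fun i => nx i g) bk; last by exists y.
  by have [/Ec[/(_ (nx i g)) h _ _] _] := (ib, erefl tt); apply: h; case: (nxP i g gk ib).
have [x [delta [dk xd xm dc]]] := closure_sequence tr kr tk (fun x xk => (FP x xk).1) jk.
have [t0 ts _] := tr.
exists delta; last by case: (xd _ t0) => h1 h2; exact: ord_lt_trans h1 h2.
split=> // i ib; have [_ cl _] := Ec i ib; apply: cl => // g /dc[k kt gx].
have xkk : x k <o kappa by apply: ord_lt_trans dk; exact: (xd k kt).2.
have [En xn] := nxP i (x k) xkk ib.
exists (nx i (x k)); split=> //; first exact: ord_lt_trans xn.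
right; apply: ord_lt_trans ((FP _ xkk).2 i ib) _.
apply: ord_lt_trans (xm _ _ (ord_succ_lt k) (ts _ kt)).2 _.
exact: (xd _ (ts _ kt)).2.
Qed.

(* The largest element of [E] that is at most [g], when [E] is closed. *)
Definition club_floor (E : set ON) (g : ON) : ON :=
  ord_min [set y | forall x, E x -> x <=o g -> x <=o y].

Lemma club_floor_ge (E : set ON) g x : E x -> x <=o g -> x <=o club_floor E g.
Proof.
move=> Ex xg; have [|+ _] := @ord_minP [set y | forall x, E x -> x <=o g -> x <=o y].
  by exists g.
exact.
Qed.

Lemma club_floor_min (E : set ON) g y :
  (forall x, E x -> x <=o g -> x <=o y) -> club_floor E g <=o y.
Proof. exact: ord_min_le. Qed.

Lemma club_floor_le (E : set ON) g : club_floor E g <=o g.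
Proof. exact: club_floor_min. Qed.

Lemma club_floor_mem (kappa : ON) (E : set ON) g :
  club kappa E -> g <o kappa -> E (club_floor E g).
Proof.
move=> [_ cl _] gk; apply: cl => [|d dp].
  exact: ord_le_lt_trans (club_floor_le E g) gk.
apply: contrapT => nx; apply: (ord_lt_nle dp); apply: club_floor_min => x Ex xg.
by apply: ord_nlt_le => dx; apply: nx; exists x; split=> //; exact: club_floor_ge.
Qed.

Lemma club_floor_mono (E : set ON) g g' : g <=o g' -> club_floor E g <=o club_floor E g'.
Proof.
move=> gg'; apply: club_floor_min => x Ex xg; apply: club_floor_ge => //.
exact: ord_le_trans xg gg'.
Qed.

Lemma club_floor_sub (E E' : set ON) g : E `<=` E' -> club_floor E g <=o club_floor E' g.
Proof. by move=> EE'; apply: club_floor_min => x /EE' Ex xg; exact: club_floor_ge. Qed.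

(* Shrink a club [mu] times, each time by a club not guessed by the sets
   [C a = {sup (E `&` e a k) : k < theta}]. At a limit [d] of the intersection,
   each of these suprema only decreases, so they all stabilise before stage [mu],
   and then lie in the club chosen against them. *)
Lemma club_guessing (theta mu kappa : ON) :
  is_reg theta -> is_reg mu -> is_reg kappa -> theta <o mu -> mu <o kappa ->
  exists C : ON -> ON -> ON, forall E, club kappa E ->
  exists2 a, a <o kappa & [/\ forall k, k <o theta -> E (C a k),
    forall k l, l <=o k -> k <o theta -> C a l <=o C a k &
    forall k, k <o theta -> exists2 l, l <o theta & C a k <o C a l].
Proof.
move=> tr mr kr tm mk; have tk := ord_lt_trans tm mk.
pose G (C : ON -> ON -> ON) E := exists2 a, a <o kappa & [/\ forall k, k <o theta -> E (C a k),
    forall k l, l <=o k -> k <o theta -> C a l <=o C a k &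
    forall k, k <o theta -> exists2 l, l <o theta & C a k <o C a l].
change (exists C, forall E, club kappa E -> G C E).
apply: contrapT => nG.
have {nG} /choice[nE nEP] C : exists E, club kappa E /\ ~ G C E.
  apply: contrapT => nE; apply: nG; exists C => E cE; apply: contrapT => nCE.
  by apply: nE; exists E.
(* Ladders: [e d] will be an increasing [theta]-sequence cofinal in [d] whenever one exists. *)
pose L d (x : ON -> ON) := [/\ forall k, k <o theta -> x k <o d,
  forall k l, l <o k -> k <o theta -> x l <o x k &
  forall g, g <o d -> exists2 k, k <o theta & g <o x k].
have /choice[e eP] d : exists e, (exists x, L d x) -> L d e.
  by have [[x Lx]|] := pselect (exists x, L d x); [exists x|exists id].
pose Cf (E : set ON) a k := club_floor E (e a k).
pose P i (Es : ON -> set ON) (E : set ON) :=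
  E = [set x | x <o kappa /\ forall j, j <o i -> nE (Cf (Es j)) x].
have loc i Es Es' E : (forall j, j <o i -> Es j = Es' j) -> P i Es E -> P i Es' E.
  move=> EE' ->; apply/seteqP; split=> x [xk xP]; split=> // j ji.
    by rewrite -EE' //; exact: xP.
  by rewrite EE' //; exact: xP.
have [Es EsP'] := transfinite_choice set0 loc.
have {EsP'} EsP i : P i Es (Es i) by apply: EsP'; eexists.
have Ec i : i <o kappa -> club kappa (Es i).
  by move=> ik; rewrite EsP; apply: (club_bigcap tr) => // j _; exact: (nEP _).1.
have Ed i j : i <=o j -> Es j `<=` Es i.
  move=> ij x; rewrite EsP (EsP i) => -[xk xP]; split=> // l li; apply: xP.
  exact: ord_lt_le_trans ij.
(* [F g] is a point of the final club [Es mu] beyond [g], so the supremum [d] of a sequence closed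
   under [F] is a limit of that club and has a ladder. *)
have /choice[F FP] g : exists y, g <o kappa -> Es mu y /\ g <o y.
  have [gk|] := pselect (g <o kappa); last by exists ord0.
  by have [_ _ /(_ g gk)[y]] := Ec _ mk; exists y.
have Fk g : g <o kappa -> F g <o kappa.
  by move=> gk; have [h _ _] := Ec _ mk; apply: h; exact: (FP g gk).1.
have [k0 _ _] := kr.
have [x [d [dk xd xm dc]]] := closure_sequence tr kr tk Fk k0.
have [e1 e2 e3] : L d (e d).
  by apply: eP; exists x; split=> // [k /xd[]|k l lk /(xm _ _ lk)[]].
have /choice[i0 i0P] k : exists i0, k <o theta -> i0 <o mu /\
    forall i, i0 <=o i -> i <o mu -> Cf (Es i) d k = Cf (Es i0) d k.
  have [kt|] := pselect (k <o theta); last by exists ord0.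
  have [|y [i0 [i0m i0y]] ym] := @ord_least [set y | exists i, i <o mu /\ Cf (Es i) d k = y].
    by have [m0 _ _] := mr; exists (Cf (Es ord0) d k), ord0.
  exists i0 => _; split=> // i i0i im; apply: ord_le_anti.
    by apply: club_floor_sub; exact: Ed.
  by rewrite i0y; apply: ym; exists i.
have [m0 ms mb] := mr.
(* As [mu] is regular and [theta < mu], one stage [i] lies past all stabilisation stages. *)
have [i im iP] := mb theta i0 tm (fun k kt => (i0P k kt).1).
apply: (nEP (Cf (Es i))).2; exists d => //; split.
(* Stages [i] and [ord_succ i] give the same floor, and [Es (ord_succ i)] lies inside the club
   chosen against the guess made at stage [i]. *)
- move=> k kt; have -> : Cf (Es i) d k = Cf (Es (ord_succ i)) d k.
    rewrite (i0P k kt).2 //; last by right; exact: iP.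
    rewrite [RHS](i0P k kt).2 //; last exact: ms.
    right; apply: ord_lt_trans (iP k kt) (ord_succ_lt i).
  have : Es (ord_succ i) (Cf (Es (ord_succ i)) d k).
    apply: club_floor_mem; first by apply: Ec; apply: ord_lt_trans mk; exact: ms.
    by apply: ord_lt_trans dk; exact: e1.
  by rewrite {1}EsP => -[_ /(_ i (ord_succ_lt i))].
- move=> k l [->|lk] kt; first by left.
  by apply: club_floor_mono; right; exact: e2.
(* The point [F (x l)] of [Es mu] separates two ladder points, so the floors keep growing. *)
- move=> k kt; have [l lt_ xl] := dc _ (e1 k kt).
  have xlk : x l <o kappa by apply: ord_lt_trans dk; exact: (xd l lt_).2.
  have [EF xF] := FP _ xlk.
  have Fd : F (x l) <o d.
    have [_ ts _] := tr.
    apply: ord_lt_trans (xm _ _ (ord_succ_lt l) (ts _ lt_)).2 _; exact: (xd _ (ts _ lt_)).2.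
  have [l' lt' Fl'] := e3 _ Fd; exists l' => //.
  apply: ord_le_lt_trans (club_floor_le _ _) _; apply: ord_lt_le_trans (ord_lt_trans xl xF) _.
  apply: club_floor_ge; last by right.
  by apply: Ed EF; right.
Qed.

(** * Construction of the sequence *)

Lemma ideal_sub T (I : set (set T)) (X Y : set T) : is_ideal I -> I Y -> X `<=` Y -> I X.
Proof. by case=> _ + _ IY XY; apply; eassumption. Qed.

Lemma ideal_sub2 T (I : set (set T)) (X Y Z : set T) :
  is_ideal I -> I Y -> I Z -> (forall a, X a -> Y a \/ Z a) -> I X.
Proof. by move=> HI IY IZ XYZ; apply: (ideal_sub HI _ XYZ); case: HI => _ _; apply. Qed.

Lemma le_mod_trans T (I : set (set T)) (v u w : T -> ON) :
  is_ideal I -> le_mod I u v -> le_mod I v w -> le_mod I u w.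
Proof.
move=> HI uv vw; apply: (ideal_sub2 HI uv vw) => a /= nuw.
by apply: contrapT => /not_orP[/contrapT h1 /contrapT h2]; apply: nuw; exact: ord_le_trans h2.
Qed.

Lemma lt_le_mod T (I : set (set T)) (u v : T -> ON) :
  is_ideal I -> lt_mod I u v -> le_mod I u v.
Proof. by move=> HI uv; apply: (ideal_sub HI uv) => a /= + h; apply; right. Qed.

Lemma pointwise_le_mod T (I : set (set T)) (u v : T -> ON) :
  is_ideal I -> (forall a, u a <=o v a) -> le_mod I u v.
Proof. by move=> HI uv; case: (HI) => I0 _ _; apply: (ideal_sub HI I0) => a /= []. Qed.

Lemma increasing_le_mod T (I : set (set T)) lambda (s : ON -> T -> ON) eta xi :
  is_ideal I -> increasing_mod I lambda s -> eta <=o xi -> xi <o lambda ->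
  le_mod I (s eta) (s xi).
Proof.
move=> HI si [->|ex] xl; first by apply: pointwise_le_mod => // a; left.
by apply: lt_le_mod => //; exact: si.
Qed.

(** If every point [a] left the sets [B k] from some [r a] on, each set where [j < r] would be
    positive, and by indecomposability so would its part where [r <= j'] for some [j']. Iterating
    gives [theta] disjoint positive slices, against weak saturation. *)
Lemma regular_ideal_common T (I : set (set T)) (theta : ON) (B : ON -> set T) :
  is_ideal I -> is_reg theta -> regular_ideal I theta ->
  (forall k, k <o theta -> positive I (B k)) ->
  exists a, forall k, k <o theta -> exists l, [/\ k <=o l, l <o theta & B l a].
Proof.
move=> HI [t0 ts tb] [ws ind] Bp; apply: contrapT => nex.
have I0 : I set0 by case: HI.
have /choice[r rP] a : exists k, k <o theta /\ forall l, k <=o l -> l <o theta -> ~ B l a.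
  apply: contrapT => nk; apply: nex; exists a => k kt; apply: contrapT => nl.
  by apply: nk; exists k; split=> // l kl lt_ Bl; apply: nl; exists l.
have pos j : j <o theta -> positive I [set a | j <o r a].
  move=> jt /(ideal_sub HI) IB; apply: (Bp j jt); apply: IB => a Ba /=.
  by apply: ord_nle_lt => rj; exact: (rP a).2 Ba.
have /choice[N NP] j : exists j', j <o theta ->
    j' <o theta /\ positive I [set a | j <o r a /\ r a <=o j'].
  have [jt|] := pselect (j <o theta); last by exists ord0.
  apply: contrapT => nj; apply: (pos j jt).
  have h : I (\bigcup_(i in below theta) [set a | j <o r a /\ r a <=o i]).
    apply: ind => [j' jt'|i k ik _ a [ja ai]].
      by apply: contrapT => np; apply: nj; exists j'.
    by split=> //; apply: ord_le_trans ai _; right.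
  apply: (ideal_sub HI h) => a ja; exists (r a); first exact: (rP a).1.
  by split=> //; left.
(* The slice of points whose [r] lies above all earlier cuts [G l] and is at most [u]. *)
pose V (k : ON) (G : ON -> ON) u : set T := [set a | (forall l, l <o k -> G l <o r a) /\ r a <=o u].
pose P k G u := u <o theta /\ positive I (V k G u).
have loc k G G' u : (forall l, l <o k -> G l = G' l) -> P k G u -> P k G' u.
  move=> GG' [ut Vp]; split=> // /(ideal_sub HI) IV; apply: Vp; apply: IV => a [aG ra].
  by split=> // l lk; rewrite -GG' //; exact: aG.
have [G GP'] := transfinite_choice ord0 loc.
have {GP'} GP k : k <o theta -> P k G (G k).
  elim/ord_ind: k => k IH kt; apply: GP'.
  have [s st sP] := tb k G kt (fun l lk => (IH l lk (ord_lt_trans lk kt)).1).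
  have [Nt Np] := NP s st; exists (N s); split=> // /(ideal_sub HI) IV.
  apply: Np; apply: IV => a [sa aN]; split=> // l lk; exact: ord_lt_trans (sP l lk) sa.
pose U : set T := [set a | exists k, [/\ k <> ord0, k <o theta & V k G (G k) a]].
(* Piece [ord0] is the complement of the other slices, so that the pieces cover everything. *)
pose D k : set T := if `[< k = ord0 >] then ~` U else V k G (G k).
have Vdisj k l a : V k G (G k) a -> V l G (G l) a -> k = l.
  move=> [ak ka] [al la]; case: (ord_trichotomy k l) => // [/al|/ak] h.
    by case: (ord_lt_nle h).
  by case: (ord_lt_nle h).
have VD k : V k G (G k) `<=` D k.
  move=> a Va; rewrite /D; case: asboolP => // k0 [k' [k'0 _ Vk']].
  by apply: k'0; rewrite -k0; exact: Vdisj Vk' Va.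
case: ws; exists D; last first.
  by move=> i /GP[_ Vp] /(ideal_sub HI) ID; apply: Vp; apply: ID; exact: VD.
split.
- rewrite /cover -subTset => a _.
  have [[k [k0 kt Vk]]|nU] := pselect (U a); first by exists k => //; exact: VD.
  by exists ord0 => //; rewrite /D; case: asboolP.
- move=> i j it jt [a []]; rewrite /D.
  case: asboolP => [->|i0]; case: asboolP => [->|j0] //.
  + by move=> nU Vj; case: nU; exists j.
  + by move=> Vi nU; case: nU; exists i.
  + exact: Vdisj.
- move=> i it; have [_ Vp] := GP i it; apply: contrapT => De; apply: Vp.
  apply: (ideal_sub HI I0) => a Va; apply: De; exists a; exact: VD.
Qed.

(* The third clause is continuity at limits; [i = ord0] counts as a limit, which
   forces [e ord0 = ord0]. *)
Definition normal_seq (kappa delta : ON) (e : ON -> ON) : Prop :=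
  [/\ forall i, i <o kappa -> e i <o delta,
      forall i j, j <o i -> i <o kappa -> e j <o e i,
      forall i v, i <o kappa -> (forall j, j <o i -> ord_succ j <o i) ->
        (forall j, j <o i -> e j <=o v) -> e i <=o v &
      forall g, g <o delta -> exists2 i, i <o kappa & g <o e i].

(** A normal sequence dominates the identity. Hence only lengths up to [xi] can occur at [xi], which
    are fewer than [lambda]. *)
Lemma normal_seq_ge (kappa delta : ON) e : normal_seq kappa delta e -> kappa <=o delta.
Proof.
move=> [ed em _ _]; apply: ord_nlt_le => dk.
have ge i : i <o kappa -> i <=o e i.
  elim/ord_ind: i => i IH ik; apply: ord_nlt_le => ei.
  by apply: (ord_lt_nle (em _ _ ei ik)); apply: IH => //; exact: ord_lt_trans ik.
by apply: (ord_lt_nle (ed _ dk)); exact: ge.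
Qed.

(** Let [F i] be an index at which each sequence has passed the value of the other at [i]. Below the
    supremum of a sequence closed under [F] the two interleave, so continuity makes them agree
    there. *)
Lemma club_agree (theta kappa delta : ON) (e e' : ON -> ON) :
  is_reg theta -> is_reg kappa -> theta <o kappa ->
  normal_seq kappa delta e -> normal_seq kappa delta e' ->
  club kappa [set i | i <o kappa /\ e i = e' i].
Proof.
move=> tr kr tk [e1 e2 e3 e4] [f1 f2 f3 f4]; have [k0 ks _] := kr; split=> [i []//|d dk dP|j jk].
  apply: contrapT => nd.
  have dP' g : g <o d -> exists x, [/\ x <o kappa, e x = e' x, g <o x & x <o d].
    move=> /dP[x [[xk ex] gx [xd|xd]]]; first by case: nd; rewrite -xd.
    by exists x.
  have dl g : g <o d -> ord_succ g <o d.
    by move=> /dP'[x [_ _ gx xd]]; apply: ord_le_lt_trans xd; exact: ord_succ_le.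
  apply: nd; split=> //; apply: ord_le_anti; [apply: e3|apply: f3] => // g /dP'[x [xk ex gx xd]]; right.
    by apply: ord_lt_trans (e2 _ _ gx xk) _; rewrite ex; exact: f2.
  by apply: ord_lt_trans (f2 _ _ gx xk) _; rewrite -ex; exact: e2.
have /choice[F FP] i : exists y, i <o kappa -> [/\ y <o kappa, e i <o e' y & e' i <o e y].
  have [ik|] := pselect (i <o kappa); last by exists ord0.
  have [y yk ey] := f4 _ (e1 _ ik); have [z zk fz] := e4 _ (f1 _ ik).
  have mk := ord_join_lt yk zk; exists (ord_join y z) => _; split=> //.
    by have [<-//|h] := ord_le_joinl y z; apply: ord_lt_trans ey (f2 _ _ h mk).
  by have [<-//|h] := ord_le_joinr y z; apply: ord_lt_trans fz (e2 _ _ h mk).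
have Fk i : i <o kappa -> F i <o kappa by case/FP.
have [x [d [dk xd xm dc]]] := closure_sequence tr kr tk Fk jk.
have [t0 ts _] := tr.
exists d; last by case: (xd _ t0) => h1 h2; exact: ord_lt_trans h1 h2.
have dl g : g <o d -> ord_succ g <o d.
  by move=> /dc[k /xd[_ h] /ord_succ_le gx]; exact: ord_le_lt_trans gx h.
split=> //; apply: ord_le_anti; [apply: e3|apply: f3] => // g /dc[k kt gx]; right.
- have xk : x k <o kappa by apply: ord_lt_trans dk; exact: (xd k kt).2.
  have [h1 h2 h3] := FP _ xk; apply: ord_lt_trans (e2 _ _ gx xk) _.
  apply: ord_lt_trans h2 _; apply: f2 => //.
  apply: ord_lt_trans (xm _ _ (ord_succ_lt k) (ts _ kt)).2 _; exact: (xd _ (ts _ kt)).2.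
- have xk : x k <o kappa by apply: ord_lt_trans dk; exact: (xd k kt).2.
  have [h1 h2 h3] := FP _ xk; apply: ord_lt_trans (f2 _ _ gx xk) _.
  apply: ord_lt_trans h3 _; apply: e2 => //.
  apply: ord_lt_trans (xm _ _ (ord_succ_lt k) (ts _ kt)).2 _; exact: (xd _ (ts _ kt)).2.
Qed.

Lemma eq_ord_sup (b : ON) (h h' : ON -> ON) :
  (forall d, d <o b -> h d = h' d) -> ord_sup b h = ord_sup b h'.
Proof.
move=> hh; apply: ord_le_anti; apply: ord_sup_le => d db.
  by rewrite hh //; exact: ord_sup_ge.
by rewrite -hh //; exact: ord_sup_ge.
Qed.

Lemma directed_below (A : set ON) (I : set (set A)) (lambda b : ON) (u : ON -> A -> ON) :
  is_cardinal lambda -> directed_mod I lambda -> b <o lambda ->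
  (forall d, d <o b -> ord_prod A (u d)) ->
  exists2 h, ord_prod A h & forall d, d <o b -> le_mod I (u d) h.
Proof.
move=> lc dir bl up; have [||h hp hu] := dir (u @` below b).
- by move=> _ [d /up ? <-].
- have ub : u @` below b #<= below b by exact: card_image_le.
  split; first exact: card_le_trans ub (card_below (ord_ltW bl)).
  by move=> lu; apply: (lc _ bl); exact: card_le_trans ub.
- by exists h => // d db; apply: hu; exists d.
Qed.

(** At stage [xi] directedness is applied to the earlier [g eta], and to one pointwise supremum for
    each length [kappa] up to [xi]. *)
Lemma ladder_dominating_sequence (A : set ON) (I : set (set A)) (lambda : ON)
    (f : ON -> A -> ON) :
  (forall a : A, is_reg (val a)) -> is_ideal I -> is_cardinal lambda -> is_reg lambda ->
  directed_mod I lambda -> (forall xi, xi <o lambda -> ord_prod A (f xi)) ->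
  exists g : ON -> A -> ON, [/\ forall xi, xi <o lambda -> ord_prod A (g xi),
    increasing_mod I lambda g,
    forall xi, xi <o lambda -> forall a : A, f xi a <o g (ord_succ xi) a &
    forall kappa xi, xi <o lambda -> I [set a : A | val a <=o kappa] ->
      (exists e, normal_seq kappa xi e) ->
      exists2 e, normal_seq kappa xi e &
        le_mod I (fun a => ord_sup kappa (fun i => g (e i) a)) (g xi)].
Proof.
move=> Ar HI lc lr dir fp; have [l0 ls lb] := lr.
pose P xi (G : ON -> A -> ON) u := [/\ ord_prod A u,
  forall eta, eta <o xi -> lt_mod I (G eta) u,
  forall eta, xi = ord_succ eta -> forall a : A, f eta a <o u a &
  forall kappa, I [set a : A | val a <=o kappa] ->
    (exists e, normal_seq kappa xi e) ->
    exists2 e, normal_seq kappa xi e &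
      le_mod I (fun a => ord_sup kappa (fun i => G (e i) a)) u].
have loc xi G G' u : (forall eta, eta <o xi -> G eta = G' eta) -> P xi G u -> P xi G' u.
  move=> GG' [P1 P2 P3 P4]; split=> // [eta ex|kappa Ik /(P4 _ Ik)[e ne eu]].
    by rewrite -GG' //; exact: P2.
  exists e => //; have [ek _ _ _] := ne.
  suff -> : (fun a => ord_sup kappa (fun i => G' (e i) a)) =
            (fun a => ord_sup kappa (fun i => G (e i) a)) by [].
  by apply/funext => a; apply: eq_ord_sup => i /ek/GG' ->.
have [g gP'] := transfinite_choice (fun=> ord0) loc.
have {gP'} gP xi : xi <o lambda -> P xi g (g xi).
  elim/ord_ind: xi => xi IH xl; apply: gP'.
  have gp eta : eta <o xi -> ord_prod A (g eta).
    by move=> ex; case: (IH eta ex (ord_lt_trans ex xl)).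
  have /choice[e eP] kappa : exists e, (exists e, normal_seq kappa xi e) -> normal_seq kappa xi e.
    by have [[e ee]|] := pselect (exists e, normal_seq kappa xi e); [exists e|exists id].
  (* Where [val a <= kappa] the supremum might reach [val a], so it is replaced by [ord0]; elsewhere
     regularity of [val a] bounds it. *)
  pose s kappa (a : A) := if `[< (exists e, normal_seq kappa xi e) /\ kappa <o val a >]
    then ord_sup kappa (fun i => g (e kappa i) a) else ord0.
  have sp kappa : ord_prod A (s kappa).
    move=> a; rewrite /s; case: asboolP => [[/eP ne ka]|_]; last by case: (Ar a).
    have [ek _ _ _] := ne.
    by apply: ord_sup_lt_reg => // i /ek/gp; apply.
  have [h1 h1p h1u] := directed_below lc dir xl gp.
  have [h2 h2p h2u] := directed_below lc dir (ls _ xl) (fun k _ => sp k).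
  have [fp' fp'p fp'P] : exists2 u, ord_prod A u & forall eta, xi = ord_succ eta -> u = f eta.
    have [[eta xE]|nx] := pselect (exists eta, xi = ord_succ eta).
      exists (f eta) => [|eta']; last by rewrite xE => /ord_succ_inj ->.
      by apply: fp; apply: ord_lt_trans xl; rewrite xE; exact: ord_succ_lt.
    by exists (fun=> ord0) => [a|eta ee]; [case: (Ar a)|case: nx; exists eta].
  (* The successor turns [<=] modulo [I] into [<], and makes the domination of [fp'] strict at every
     coordinate. *)
  pose u a := ord_succ (ord_join (fp' a) (ord_join (h1 a) (h2 a))).
  have h1u' a : h1 a <o u a.
    apply/ord_lt_succ; apply: ord_le_trans (ord_le_joinl (h1 a) (h2 a)) _; exact: ord_le_joinr.
  have h2u' a : h2 a <o u a.
    apply/ord_lt_succ; apply: ord_le_trans (ord_le_joinr (h1 a) (h2 a)) _; exact: ord_le_joinr.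
  exists u; split.
  - by move=> a; case: (Ar a) => _ + _; apply; do ?apply: ord_join_lt.
  - move=> eta ex; apply: (ideal_sub HI (h1u eta ex)) => a /= + h; apply.
    exact: ord_le_lt_trans h (h1u' a).
  - move=> eta /fp'P <- a; apply/ord_lt_succ; exact: ord_le_joinl.
  - move=> kappa Ik ne; exists (e kappa); first exact: eP.
    have kx : kappa <o ord_succ xi by apply/ord_lt_succ/normal_seq_ge/eP.
    apply: (ideal_sub2 HI Ik (h2u kappa kx)) => a /= nsu.
    have [|/ord_nle_lt ka] := pselect (val a <=o kappa); [by left|right].
    rewrite /s; case: asboolP => [_ h|[]//]; apply: nsu.
    by right; apply: ord_le_lt_trans h (h2u' a).
exists g; split.
- by move=> xi /gP[].
- by move=> eta xi ex /gP[_ h _ _]; exact: h.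
- by move=> xi /ls/gP[_ _ h _] a; exact: h.
- by move=> kappa xi /gP[_ _ _ h]; exact: h.
Qed.

(** * Stability of projections *)

(** Each value [s d] has a stage [t d] by which [phi] has passed it, if it ever does. These fewer
    than [theta] stages are bounded by some [g], and a rise of [phi] after [g] would pass a value
    too late. *)
Lemma small_range_stable (theta b top : ON) (s phi : ON -> ON) :
  is_reg theta -> b <o theta ->
  (forall k l, l <=o k -> k <o theta -> phi l <=o phi k) ->
  (forall k, k <o theta -> phi k <=o top) ->
  (forall k, k <o theta -> phi k = top \/ exists2 d, d <o b & phi k = s d) ->
  exists2 g, g <o theta & forall k l, g <=o k -> k <o theta -> l <o theta -> ~ phi k <o phi l.
Proof.
move=> [t0 _ tb] bt mono ptop prange.
have /choice[t tP] d : exists k, k <o theta /\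
    ((exists2 l, l <o theta & s d <o phi l) -> s d <o phi k).
  have [[k kt h]|nh] := pselect (exists2 l, l <o theta & s d <o phi l).
    by exists k.
  by exists ord0.
have [g gt gP] := tb b t bt (fun d _ => (tP d).1).
exists g => // k l gk kt lt_ kl; have := prange k kt.
case=> [ke|[d db ke]]; first by apply: (ord_lt_nle kl); rewrite ke; exact: ptop.
have : s d <o phi (t d) by apply: (tP d).2; exists l; rewrite -?ke.
rewrite -ke => /ord_lt_nle; apply; apply: mono => //.
by apply: ord_le_trans gk; right; exact: gP.
Qed.

Section Projections.
Variables (top b : ON) (s : ON -> ON).

(** Including [top] gives every [x <= top] a projection; in the applications [top] is the cardinal
    [val a]. *)
Definition proj_set : set ON := [set y | y = top \/ exists2 d, d <o b & y = s d].

Definition proj (x : ON) : ON := ord_min [set y | proj_set y /\ x <=o y].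

Lemma projP (x : ON) : x <=o top ->
  [/\ proj_set (proj x), x <=o proj x & forall y, proj_set y -> x <=o y -> proj x <=o y].
Proof.
move=> xt; have [|[h1 h2] h3] := @ord_minP [set y | proj_set y /\ x <=o y].
  by exists top; split=> //; left.
by split=> // y Xy xy; apply: h3.
Qed.

Lemma proj_mono (x x' : ON) : x <=o x' -> x' <=o top -> proj x <=o proj x'.
Proof.
move=> xx' xt; have [h1 h2 _] := projP xt.
have [_ _] := projP (ord_le_trans xx' xt); apply=> //; exact: ord_le_trans h2.
Qed.

Lemma proj_le_top (x : ON) : x <=o top -> proj x <=o top.
Proof. by move=> xt; have [_ _] := projP xt; apply=> //; left. Qed.

End Projections.

Section Stabilization.
Variables (A : set ON) (I : set (set A)) (lambda theta mu kappa : ON).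
Variable g : ON -> A -> ON.
Hypotheses (HI : is_ideal I) (lr : is_reg lambda) (tr : is_reg theta)
  (mr : is_reg mu) (kr : is_reg kappa)
  (tm : theta <o mu) (mk : mu <o kappa) (kl : kappa <o lambda)
  (It : regular_ideal I theta)
  (gp : forall xi, xi <o lambda -> ord_prod A (g xi))
  (gi : increasing_mod I lambda g)
  (gs : forall xi, xi <o lambda -> (exists e, normal_seq kappa xi e) ->
      exists2 e, normal_seq kappa xi e &
        le_mod I (fun a => ord_sup kappa (fun i => g (e i) a)) (g xi)).

(* The pointwise supremum of [g (xi i)] over the part of [{c l : l < theta}] up to
   [j]; it depends only on [xi] restricted to [i <= j]. *)
Definition guess_sup (c : ON -> ON) (xi : ON -> ON) (j : ON) (a : A) : ON :=
  ord_sup theta (fun l => if `[< c l <=o j >] then g (xi (c l)) a else ord0).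

Lemma guess_sup_mono c xi j j' a : j <=o j' -> guess_sup c xi j a <=o guess_sup c xi j' a.
Proof.
move=> jj'; apply: ord_sup_le => l lt_; case: asboolP => [clj|_]; last exact: ord0_le.
have := ord_sup_ge (fun l => if `[< c l <=o j' >] then g (xi (c l)) a else ord0) lt_.
by case: asboolP => // -[]; exact: ord_le_trans jj'.
Qed.

Lemma proj_stable (b : A -> ON) (s : A -> ON -> ON) :
  (forall a, b a <o theta) ->
  exists2 xi0, xi0 <o lambda & forall xi, xi0 <=o xi -> xi <o lambda ->
    I [set a : A | proj (val a) (b a) (s a) (g xi a) <> proj (val a) (b a) (s a) (g xi0 a)].
Proof.
move=> bt; apply: contrapT => nst.
have [l0 ls lb] := lr; have [k0 ks kb] := kr; have [t0 ts tb] := tr.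
have tk := ord_lt_trans tm mk.
pose pr (u : A -> ON) a := proj (val a) (b a) (s a) (u a).
pose J (u v : A -> ON) := [set a : A | pr u a <o pr v a].
have gtop xi a : xi <o lambda -> g xi a <=o val a by move=> /gp; right.
have gle := fun eta xi => increasing_le_mod (eta := eta) (xi := xi) HI gi.
(* As [g] is increasing modulo [I], a change of the projections on a positive set must be a rise on
   a positive set. *)
have jump xi : xi <o lambda -> exists eta, [/\ xi <=o eta, eta <o lambda & ~ I (J (g xi) (g eta))].
  move=> xl; apply: contrapT => nj; apply: nst; exists xi => // eta xe el.
  have IJ : I (J (g xi) (g eta)) by apply: contrapT => nIJ; apply: nj; exists eta.
  apply: (ideal_sub2 HI IJ (gle _ _ xe el)) => a /= np.
  have [ge|] := pselect (g xi a <=o g eta a); last by right.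
  by left; have := proj_mono (b a) (s a) ge (gtop _ a el); case=> // e; case: np.
have [C CP] := club_guessing tr mr kr tm mk.
pose h xi al j := guess_sup (C al) xi j.
(* What a later value [v] owes to step [j]: a rise of the projections on a positive set and, for
   each of the [kappa] guesses, a bound [g v] on the partial supremum if any [g eta] bounds it. *)
pose Q (xi : ON -> ON) j v := [/\ xi j <o v, ~ I (J (g (xi j)) (g v)) &
  forall al, al <o kappa -> (exists2 eta, eta <o lambda & le_mod I (h xi al j) (g eta)) ->
    le_mod I (h xi al j) (g v)].
have Qup xi j v v' : v <=o v' -> v' <o lambda -> Q xi j v -> Q xi j v'.
  move=> vv' vl [Q1 Q2 Q3]; split.
  - exact: ord_lt_le_trans vv'.
  - move=> IJ; apply: Q2; apply: (ideal_sub2 HI IJ (gle _ _ vv' vl)) => a /= jv.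
    have [ge|] := pselect (g v a <=o g v' a); last by right.
    left; apply: ord_lt_le_trans jv _; apply: proj_mono ge _; exact: gtop.
  - by move=> al ak /(Q3 _ ak) hv; apply: (le_mod_trans HI hv) (gle _ _ vv' vl).
have Qex xi j : xi j <o lambda -> exists2 v, v <o lambda & Q xi j v.
  move=> xl; have [eta [xe el nJ]] := jump _ xl.
  have /choice[et etP] al : exists y, y <o lambda /\
     ((exists2 eta, eta <o lambda & le_mod I (h xi al j) (g eta)) -> le_mod I (h xi al j) (g y)).
    have [[y yl hy]|ny] := pselect (exists2 eta, eta <o lambda & le_mod I (h xi al j) (g eta)).
      by exists y.
    by exists ord0.
  have [y yl yP] := lb kappa et kl (fun al _ => (etP al).1).
  have vl : ord_join (ord_succ eta) y <o lambda by apply: ord_join_lt => //; exact: ls.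
  exists (ord_join (ord_succ eta) y) => //.
  have ev : eta <o ord_join (ord_succ eta) y.
    by apply: ord_lt_le_trans (ord_succ_lt eta) (ord_le_joinl _ _).
  split.
  - exact: ord_le_lt_trans ev.
  - move=> IJ; apply: nJ; apply: (ideal_sub2 HI IJ (gle _ _ (ord_ltW ev) vl)) => a /= jv.
    have [ge|] := pselect (g eta a <=o g (ord_join (ord_succ eta) y) a); last by right.
    left; apply: ord_lt_le_trans jv _; apply: proj_mono ge _; exact: gtop.
  - move=> al ak /(etP al).2 he; apply: (le_mod_trans HI he); apply: gle => //.
    by apply: ord_le_trans (ord_le_joinr _ _); right; exact: yP.
(* Taking the least admissible value is what makes [xi] continuous. *)
pose P i xi u := u = ord_min [set v | v <o lambda /\ forall j, j <o i -> Q xi j v].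
have hloc i xi xi' al j : (forall j, j <o i -> xi j = xi' j) -> j <o i -> h xi al j = h xi' al j.
  move=> xx' ji; apply/funext => a; apply: eq_ord_sup => l lt_; case: asboolP => // cj.
  by rewrite xx' //; exact: ord_le_lt_trans ji.
have Qloc i xi xi' j v : (forall j, j <o i -> xi j = xi' j) -> j <o i -> Q xi j v -> Q xi' j v.
  move=> xx' ji [Q1 Q2 Q3]; split; rewrite -?xx' //.
  by move=> al ak; rewrite -(hloc i xi xi') //; exact: Q3.
have loc i xi xi' u : (forall j, j <o i -> xi j = xi' j) -> P i xi u -> P i xi' u.
  move=> xx' ->; congr ord_min; apply/seteqP; split=> v [vl vQ]; split=> // j ji.
    exact: Qloc xx' ji (vQ j ji).
  by apply: (Qloc i xi') (vQ j ji) => // j' j'i; rewrite xx'.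
have [xi xiP'] := transfinite_choice ord0 loc.
have {xiP'} xiE i : xi i = ord_min [set v | v <o lambda /\ forall j, j <o i -> Q xi j v].
  by apply: xiP'; eexists.
have xiP i : i <o kappa -> xi i <o lambda /\ forall j, j <o i -> Q xi j (xi i).
  elim/ord_ind: i => i IH ik.
  have xl j : j <o i -> xi j <o lambda by move=> ji; case: (IH j ji (ord_lt_trans ji ik)).
  rewrite {1 2}xiE.
  suff /ord_minP[] : [set v | v <o lambda /\ forall j, j <o i -> Q xi j v] !=set0 by [].
  have /choice[V VP] j : exists v, j <o i -> v <o lambda /\ Q xi j v.
    have [ji|] := pselect (j <o i); last by exists ord0.
    by have [v vl vQ] := Qex xi j (xl j ji); exists v.
  have [v vl vP] := lb i V (ord_lt_trans ik kl) (fun j ji => (VP j ji).1).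
  by exists v; split=> // j ji; apply: Qup (VP j ji).2 => //; right; exact: vP.
have xim i j : j <o i -> i <o kappa -> xi j <o xi i.
  by move=> ji /xiP[_ /(_ j ji)[]].
pose d := ord_sup kappa xi.
have dl : d <o lambda by apply: ord_sup_lt_reg => // i /xiP[].
have nxi : normal_seq kappa d xi.
  split=> // [i ik|i v ik il xv|y /lt_ord_sup//].
    by apply: ord_lt_le_trans (xim _ _ (ord_succ_lt i) (ks _ ik)) _; apply: ord_sup_ge; exact: ks.
  have [lv|vl] := ord_leVlt lambda v.
    by right; apply: ord_lt_le_trans lv; exact: (xiP i ik).1.
  (* At a limit [i], [xi (ord_succ j)] already meets [Q] for [j], so an upper bound [v] of the
     earlier values is itself admissible. *)
  rewrite xiE; apply: ord_min_le; split=> // j ji.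
  apply: Qup (xv _ (il _ ji)) vl _; apply: (xiP _ _).2 (ord_succ_lt j).
  exact: ord_lt_trans (il _ ji) ik.
have [e ne eg] := gs dl (ex_intro _ xi nxi).
have [al ak [cE cm cn]] := CP _ (club_agree tr kr tk ne nxi).
pose c := C al; pose H k := h xi al (c k).
have ck k : k <o theta -> c k <o kappa by move=> /cE[].
have xck k : k <o theta -> xi (c k) <o lambda by move=> /ck/xiP[].
(* [xi] agrees with [e] on the guessed set, so [H k] lies below the supremum of [g] along [e]. *)
have Hd k : le_mod I (H k) (g d).
  apply: (le_mod_trans HI _ eg); apply: pointwise_le_mod => // a.
  apply: ord_sup_le => l lt_; case: asboolP => _; last exact: ord0_le.
  have [clk <-] := cE l lt_; exact: (ord_sup_ge (fun i => g (e i) a) clk).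
(* Since [g d] bounds [H k], the last clause of [Q] makes [g (xi v)] bound it already. *)
have Hx k v : c k <o v -> v <o kappa -> le_mod I (H k) (g (xi v)).
  move=> cv vk; have [_ /(_ _ cv)[_ _ Q3]] := xiP v vk; apply: Q3 => //.
  by exists d => //; exact: Hd.
have xH k l a : c l <=o c k -> l <o theta -> g (xi (c l)) a <=o H k a.
  move=> lk lt_.
  have := ord_sup_ge (fun l => if `[< c l <=o c k >] then g (xi (c l)) a else ord0) lt_.
  by case: asboolP.
have Htop k a : H k a <=o val a.
  apply: ord_sup_le => l lt_; case: asboolP => _; last exact: ord0_le.
  by apply: gtop; exact: xck.
have Hm k l a : l <=o k -> k <o theta -> pr (H l) a <=o pr (H k) a.
  by move=> lk kt; apply: proj_mono => //; apply: guess_sup_mono; exact: cm.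
have /choice[n nP] k : exists l, k <o theta -> l <o theta /\ c k <o c l.
  have [kt|] := pselect (k <o theta); last by exists ord0.
  by have [l lt_ cl] := cn k kt; exists l.
(* Two applications of [n]: [H k] lies below [g] at [xi (c (n k))], the projections rise from there
   to [xi (c (n (n k)))], and [H (n (n k))] dominates [g] at the latter. *)
pose B k := [set a : A | pr (H k) a <o pr (H (n (n k))) a].
have Bp k : k <o theta -> positive I (B k).
  move=> kt IB; have [k1t ck1] := nP k kt; have [k2t ck2] := nP _ k1t.
  have [_ /(_ _ ck2)[_ nIJ _]] := xiP _ (ck _ k2t); apply: nIJ.
  apply: (ideal_sub2 HI IB (Hx k _ ck1 (ck _ k1t))) => a /= jv.
  have [ge|] := pselect (H k a <=o g (xi (c (n k))) a); last by right.
  left; apply: ord_le_lt_trans (ord_lt_le_trans jv _).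
    by apply: proj_mono ge _; apply: gtop; exact: xck.
  by apply: proj_mono => //; apply: xH => //; left.
have [a aB] := regular_ideal_common HI tr It Bp.
have [] := small_range_stable (phi := fun k => pr (H k) a) (s := s a) (top := val a) tr (bt a).
- by move=> k l lk kt; exact: Hm.
- by move=> k kt; exact: proj_le_top.
- by move=> k kt; have [] := projP (b a) (s a) (Htop k a).
move=> y yt yP; have [l [yl lt_ Ba]] := aB y yt.
apply: (yP l (n (n l)) yl lt_ _ Ba).
exact: (nP _ (nP _ lt_).1).1.
Qed.

End Stabilization.

(** * Exact upper bounds *)

Lemma proj_le_more (top b b' : ON) (s : ON -> ON) x :
  b <=o b' -> x <=o top -> proj top b' s x <=o proj top b s x.
Proof.
move=> bb' xt; have [h1 h2 _] := projP b s xt; have [_ _] := projP b' s xt; apply=> //.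
case: h1 => [->|[d db ->]]; [by left|right; exists d => //].
exact: ord_lt_le_trans bb'.
Qed.

Lemma eq_proj (top b : ON) (s s' : ON -> ON) :
  (forall d, d <o b -> s d = s' d) -> proj top b s = proj top b s'.
Proof.
move=> ss'; apply/funext => x; congr ord_min; apply/seteqP.
by split=> y [[->|[d db ->]] xy]; split=> //; [left|right; exists d; rewrite ?ss'|left|
  right; exists d; rewrite ?ss'].
Qed.

Section ExactUpperBound.
Variables (A : set ON) (I : set (set A)) (lambda theta : ON).
Variable g : ON -> A -> ON.
Hypotheses (HI : is_ideal I) (lr : is_reg lambda) (tr : is_reg theta)
  (tl : theta <o lambda) (It : regular_ideal I theta)
  (gp : forall xi, xi <o lambda -> ord_prod A (g xi))
  (gi : increasing_mod I lambda g)
  (gst : forall (b : A -> ON) (s : A -> ON -> ON), (forall a, b a <o theta) ->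
    exists2 xi0, xi0 <o lambda & forall xi, xi0 <=o xi -> xi <o lambda ->
      I [set a : A | proj (val a) (b a) (s a) (g xi a) <> proj (val a) (b a) (s a) (g xi0 a)]).

Let F := g @` below lambda.
Let gtop xi a : xi <o lambda -> g xi a <=o val a.
Proof. by move=> /gp; right. Qed.

(** From [xi0] on, [g xi] lies below its own projection, which agrees modulo [I] with that of
    [g xi0]. *)
Lemma stable_proj_upper_bound (b : A -> ON) (s : A -> ON -> ON) xi0 :
  xi0 <o lambda ->
  (forall xi, xi0 <=o xi -> xi <o lambda ->
    I [set a : A | proj (val a) (b a) (s a) (g xi a) <> proj (val a) (b a) (s a) (g xi0 a)]) ->
  is_upper_bound I F (fun a => proj (val a) (b a) (s a) (g xi0 a)).
Proof.
move=> x0l st _ [xi xl <-].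
have pg eta a : eta <o lambda -> g eta a <=o proj (val a) (b a) (s a) (g eta a).
  by move=> el; case: (projP (b a) (s a) (gtop a el)).
have [xx|xx] := ord_leVlt xi xi0.
  apply: (le_mod_trans HI) (increasing_le_mod HI gi xx x0l) _.
  by apply: pointwise_le_mod => // a; exact: pg.
apply: (ideal_sub HI (st xi (ord_ltW xx) xl)) => a /= ng e; apply: ng.
by rewrite -e; exact: pg.
Qed.

Lemma least_upper_bound_exists : exists h, is_least_upper_bound I F h.
Proof.
apply: contrapT => nlub; have [t0 ts tb] := tr; have [l0 ls lb] := lr.
pose pr al (U : ON -> A -> ON) xi a := proj (val a) al (fun d => U d a) (g xi a).
(* The bound [u] improves, on a positive set, on the stable projection to the earlier bounds. *)
pose P al U u := is_upper_bound I F u /\ exists xi0, [/\ xi0 <o lambda,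
  forall xi, xi0 <=o xi -> xi <o lambda -> I [set a | pr al U xi a <> pr al U xi0 a] &
  ~ I [set a | u a <o pr al U xi0 a]].
have prloc al U U' : (forall be, be <o al -> U be = U' be) -> pr al U = pr al U'.
  move=> UU'; apply/funext => xi; apply/funext => a; rewrite /pr.
  by rewrite (@eq_proj _ _ _ (fun d => U' d a)) // => d /UU' ->.
have loc al U U' u : (forall be, be <o al -> U be = U' be) -> P al U u -> P al U' u.
  by move=> /prloc e; rewrite /P e.
have [U UP'] := transfinite_choice (fun=> ord0) loc.
have {UP'} UP al : al <o theta -> P al U (U al).
  move=> at_; apply: UP'; have [xi0 x0l st] := gst (fun a d => U d a) (fun _ : A => at_).
  have ub := stable_proj_upper_bound x0l st.
  have [u [uu nu]] : exists u, is_upper_bound I F u /\ ~ le_mod I (pr al U xi0) u.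
    apply: contrapT => nu; apply: nlub; exists (pr al U xi0); split=> // u uu.
    by apply: contrapT => nle; apply: nu; exists u.
  exists u; split=> //; exists xi0; split=> // Iu; apply: nu.
  by apply: (ideal_sub HI Iu) => a /ord_nle_lt.
have /choice[x xP] al : exists xi0, al <o theta -> [/\ xi0 <o lambda,
    forall xi, xi0 <=o xi -> xi <o lambda -> I [set a | pr al U xi a <> pr al U xi0 a] &
    ~ I [set a | U al a <o pr al U xi0 a]].
  have [/UP[_ [xi0 ?]]|] := pselect (al <o theta); first by exists xi0.
  by exists ord0.
have xl al : al <o theta -> x al <o lambda by case/xP.
(* As [theta < lambda], one index [z] lies past all the stabilisation points. *)
have [z zl zP] := lb theta x tl xl.
have Bp al : al <o theta -> positive I [set a | pr (ord_succ al) U z a <o pr al U z a].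
  move=> at_ IB; have [_ x2 x3] := xP al at_; apply: x3.
  have [Uub _] := UP al at_.
  have Iz := x2 z (ord_ltW (zP _ at_)) zl.
  have Iu : le_mod I (g z) (U al) by apply: Uub; exists z.
  have Izu : I ([set a | pr al U z a <> pr al U (x al) a] `|` [set a | ~ g z a <=o U al a]).
    by case: HI => _ _; apply.
  apply: (ideal_sub2 HI IB Izu) => a /= ul.
  have [e|] := pselect (pr al U z a = pr al U (x al) a); last by right; left.
  have [gu|] := pselect (g z a <=o U al a); last by right; right.
  left; rewrite e; apply: ord_le_lt_trans ul.
  have [_ _] := projP (ord_succ al) (fun d => U d a) (gtop a zl); apply=> //.
  by right; exists al => //; exact: ord_succ_lt.
have [a aB] := regular_ideal_common HI tr It Bp.
(* At the coordinate [a], adding candidates can only lower the projection; once its least value is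
   reached, it cannot drop again. *)
have [|y [a0 [a0t a0y]] ym] := @ord_least [set y | exists al, al <o theta /\ pr al U z a = y].
  by exists (pr ord0 U z a), ord0.
have [l [a0l lt_ Ba]] := aB _ a0t.
apply: (ord_lt_nle Ba); apply: (ord_le_trans (beta := y)).
  by rewrite -a0y; apply: proj_le_more => //; exact: gtop.
by apply: ym; exists (ord_succ l); split=> //; exact: ts.
Qed.

Lemma good_sequence : good I theta lambda g.
Proof.
have [h [hub hleast]] := least_upper_bound_exists; have [t0 ts _] := tr; have [_ ls _] := lr.
have glt xi : xi <o lambda -> lt_mod I (g xi) h.
  move=> xl; have sl := ls _ xl.
  have gs : le_mod I (g (ord_succ xi)) h by apply: hub; exists (ord_succ xi).
  apply: (ideal_sub2 HI (gi (ord_succ_lt xi) sl) gs) => a /= ng.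
  by apply: contrapT => /not_orP[/contrapT h1 /contrapT h2]; apply: ng; exact: ord_lt_le_trans h2.
exists h; first (split; first by split).
  move=> g' g'h.
  (* With [g' a] as the only candidate besides [val a], a projection of [g xi0 a] above [g' a]
     forces [g' a < g xi0 a]. *)
  have [xi0 x0l st] := gst (b := fun=> ord_succ ord0) (fun a _ => g' a) (fun=> ts _ t0).
  exists (g xi0); first by exists xi0.
  apply: (ideal_sub2 HI (hleast _ (stable_proj_upper_bound x0l st)) g'h) => a /= ng.
  apply: contrapT => /not_orP[/contrapT h1 /contrapT h2].
  apply: (ord_lt_nle h2); apply: ord_le_trans h1 _.
  have [_ _] := projP (ord_succ ord0) (fun=> g' a) (gtop a x0l); apply.
    by right; exists ord0 => //; exact: ord_succ_lt.
  exact: ord_nlt_le.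
have /choice[s sP] (a : A) := cofinalityP (h a).
(* The cofinal sequence is used only where its length is below [theta], as stability requires. *)
pose b a := if `[< cofinality (h a) <o theta >] then cofinality (h a) else ord0.
have bt a : b a <o theta by rewrite /b; case: asboolP.
have [xi0 x0l st] := gst s bt.
apply: (ideal_sub2 HI (hleast _ (stable_proj_upper_bound x0l st)) (glt xi0 x0l)) => a /= ct.
apply: contrapT => /not_orP[/contrapT h1 /contrapT h2].
(* Here [g xi0 a < h a], so some [s a d] keeps the projection below [h a], contradicting [h1]. *)
have [d dc gd] := (sP a).2 _ h2.
apply: (ord_lt_nle ((sP a).1 d dc)); apply: ord_le_trans h1 _.
have [_ _] := projP (b a) (s a) (gtop a x0l); apply=> //.
by right; exists d => //; rewrite /b; case: asboolP.
Qed.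

End ExactUpperBound.

Theorem theorem2p2 (A : set ON) (I : set (set A)) (lambda : ON)
    (f : ON -> A -> ON) :
  is_small A ->
  (forall a, A a -> is_regular_cardinal a) ->
  is_ideal I ->
  reg I <o ord_min A ->
  is_regular_cardinal lambda ->
  reg I <o lambda ->
  directed_mod I lambda ->
  (forall xi, xi <o lambda -> ord_prod A (f xi)) ->
  increasing_mod I lambda f ->
  exists g : ON -> A -> ON,
    (forall xi, xi <o lambda -> ord_prod A (g xi)) /\
    increasing_mod I lambda g /\
    (forall xi, xi <o lambda -> forall a : A, f xi a <o g (ord_succ xi) a) /\
    (forall theta,
       is_regular_cardinal theta ->
       theta <o lambda ->
       card_succ (card_succ theta) <o lambda ->
       I [set a : A | val a <=o card_succ (card_succ theta)] ->
       regular_ideal I theta ->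
       good I theta lambda g).
Proof.
move=> _ Areg HI _ lreg _ dir fp _.
have lr := regular_cardinal_reg lreg; have [lc _ _] := lreg.
have Ar (a : A) : is_reg (val a) by apply/regular_cardinal_reg/Areg/set_valP.
have [g [gp gi fg gs]] := ladder_dominating_sequence Ar HI lc lr dir fp.
exists g; split=> //; split=> //; split=> // theta treg tl kl Ik It.
have tr := regular_cardinal_reg treg; have [_ it _] := treg.
have [_ tm _] := card_succP theta; have [_ mk _] := card_succP (card_succ theta).
have im : infinite_set (below (card_succ theta)).
  by move=> fm; apply: it; exact: card_le_finite (card_below (ord_ltW tm)) fm.
(* Club guessing runs on [theta] and its first two successor cardinals; [Ik] gives the supremum
   clause at the larger successor. *)
apply: good_sequence => // b s bt.
apply: (proj_stable HI lr tr (card_succ_reg it) (card_succ_reg im)) => // xi xl.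
exact: gs.
Qed.
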